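(* Let $K$ be a finite field. The theory $T_{K,\infty}$ has quantifier elimination in the expansion of $L_K$ by predicates $P_{k,n,i}(a_0,\dots,a_k)$ such that, if $A:=\langle a_0,\dots,a_k\rangle\subseteq X^n$, then $P_{k,n,i}$ codes the isomorphism type of $\hat A$ (with $i$ ranging over the possible isomorphism types). These predicates are $\exists$-definable in $L_K$, and in fact already in $L_{K\text{-vs}}\cup\{X\}$. Hence, in the language $L_{K\text{-vs}}\cup\{X\}$, the theory $T_{K,\infty}$ is near-model-complete, that is, every formula is equivalent to a boolean combination of existential ones.
   Context: Let $K$ be a finite field. Let $L_{K\text{-vs}} = \{+,0,\lambda\cdot \mid \lambda\in K\}$ be the language of $K$-vector spaces, and let $L_K$ be $L_{K\text{-vs}}$ together with unary predicates $X^n$ for $n\in\omega$; write $X := X^1$. The $L_K$-theory $T_K$ is axiomatised as follows. (1) The reduct to $L_{K\text{-vs}}$ is a $K$-vector space. (2) $X$ is closed under multiplication by every $\lambda\in K$. (3) Each $X^n$ is interpreted as the $n$-fold sum $\{x_0+\dots+x_{n-1}\mid x_j\in X\}$, with the convention $X^0=\{0\}$. (4) The parallelism relation $x\parallel y :\Leftrightarrow x+y\in X$ is an equivalence relation on $X\setminus\{0\}$; the union of an equivalence class with $\{0\}$ is called an axis (each axis is a subspace). (5) There are infinitely many axes. (6) The axes are linearly independent: if $Y_0,\dots,Y_n$ are pairwise distinct axes and $a_i\in Y_i\setminus\{0\}$, then $a_0,\dots,a_n$ are linearly independent. The theory $T_{K,\infty}$ is obtained from $T_K$ by requiring that every axis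 is infinite-dimensional. For $M\models T_K$ let $\mathcal F(M)=\bigcup_{n\in\omega}X^n(M)$. Each $a\in X^n\setminus X^{n-1}$ is a sum $m_0+\dots+m_{n-1}$ for a unique $n$-element set $\operatorname{supp}(a)=\{m_0,\dots,m_{n-1}\}$ of pairwise nonparallel elements of $X\setminus\{0\}$ ($\operatorname{supp}(0)=\emptyset$). For an axis $Y$ and $a\in\mathcal F(M)$, $\pi_Y(a)$ is the unique element of $\operatorname{supp}(a)$ lying in $Y$ if there is one, and $0$ otherwise. $\langle B\rangle$ denotes the subspace generated by $B$. For $A\subseteq\mathcal F(M)$, $\operatorname{axes}(A)$ is the set of axes $Y$ with $\pi_Y(A)\neq\{0\}$, and $\hat A$ is the subspace generated by the projections $\pi_Y(A)$ for $Y\in\operatorname{axes}(A)$. *)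

(* Defs.v *)
(* Mathematical Components, with the classical layer of MathComp-Analysis. *)
From HB Require Import structures.
From mathcomp Require Import all_boot all_algebra.
From mathcomp Require Import mathcomp_extra boolp classical_sets functions.
From mathcomp Require Import cardinality.

Set Implicit Arguments.
Unset Strict Implicit.
Unset Printing Implicit Defensive.

Import GRing.Theory.
Local Open Scope classical_set_scope.
Local Open Scope ring_scope.

(** * First-order logic *)

Record language := Language {
  fsym : Type;
  far : fsym -> nat;
  rsym : Type;
  rar : rsym -> nat }.

(* [formula L n] is the type of L-formulas whose free variables are among
   n variables, indexed by 'I_n; [formula L 0] is the type of sentences.
   In the scope of a quantifier the bound variable has index [ord0] and the
   other indices are shifted by one. *)
Inductive term (L : language) (n : nat) : Type :=
| Var of 'I_n
| App (f : fsym L) of ('I_(far f) -> term L n).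

Inductive formula (L : language) : nat -> Type :=
| FBot n : formula L n
| FEq n of term L n & term L n : formula L n
| FRel n (r : rsym L) of ('I_(rar r) -> term L n) : formula L n
| FNot n of formula L n : formula L n
| FAnd n of formula L n & formula L n : formula L n
| FOr n of formula L n & formula L n : formula L n
| FEx n of formula L n.+1 : formula L n
| FAll n of formula L n.+1 : formula L n.

Record structure (L : language) := Structure {
  carrier :> Type;
  fint : forall f : fsym L, ('I_(far f) -> carrier) -> carrier;
  rint : forall r : rsym L, ('I_(rar r) -> carrier) -> Prop }.

Fixpoint eval (L : language) (M : structure L) n (v : 'I_n -> M)
    (t : term L n) : M :=
  match t with
  | Var i => v i
  | App f ts => fint (fun j => eval v (ts j))
  end.

Definition push (T : Type) n (v : 'I_n -> T) (x : T) : 'I_n.+1 -> T :=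
  fun i => if unlift ord0 i is Some j then v j else x.

Fixpoint sat (L : language) (M : structure L) n (phi : formula L n) :
    ('I_n -> M) -> Prop :=
  match phi in formula _ n return ('I_n -> M) -> Prop with
  | FBot _ => fun=> False
  | FEq _ s t => fun v => eval v s = eval v t
  | FRel _ r ts => fun v => rint (fun j => eval v (ts j))
  | FNot _ p => fun v => ~ sat p v
  | FAnd _ p q => fun v => sat p v /\ sat q v
  | FOr _ p q => fun v => sat p v \/ sat q v
  | FEx _ p => fun v => exists x : M, sat p (push v x)
  | FAll _ p => fun v => forall x : M, sat p (push v x)
  end.

Fixpoint quantifier_free (L : language) n (phi : formula L n) : bool :=
  match phi with
  | FBot _ | FEq _ _ _ | FRel _ _ _ => true
  | FNot _ p => quantifier_free p
  | FAnd _ p q | FOr _ p q => quantifier_free p && quantifier_free q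
  | FEx _ _ | FAll _ _ => false
  end.

(* A block of existential quantifiers in front of a quantifier-free formula. *)
Fixpoint existential (L : language) n (phi : formula L n) : bool :=
  match phi with
  | FEx _ p => existential p
  | p => quantifier_free p
  end.

Fixpoint bool_comb_existential (L : language) n (phi : formula L n) : bool :=
  match phi with
  | FNot _ p => bool_comb_existential p
  | FAnd _ p q | FOr _ p q =>
      bool_comb_existential p && bool_comb_existential q
  | p => existential p
  end.

(* Equivalence modulo a theory, given by its class of models. *)
Definition equivalent_mod (L : language) (T : structure L -> Prop) n
    (phi psi : formula L n) : Prop :=
  forall M : structure L, T M ->
  forall v : 'I_n -> M, sat phi v <-> sat psi v.

Definition quantifier_elimination (L : language) (T : structure L -> Prop) :=
  forall n (phi : formula L n),
  exists psi : formula L n, quantifier_free psi /\ equivalent_mod T phi psi.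

Definition near_model_complete (L : language) (T : structure L -> Prop) :=
  forall n (phi : formula L n),
  exists psi : formula L n,
    bool_comb_existential psi /\ equivalent_mod T phi psi.

(** * The languages *)

Section Languages.
Variable K : finFieldType.

Inductive vs_fun := VAdd | VZero | VScal of K.

Definition vs_far (f : vs_fun) : nat :=
  match f with VAdd => 2 | VZero => 0 | VScal _ => 1 end.

(* The language of K-vector spaces expanded by the relation symbols R. *)
Definition L_vs_with (R : Type) (ar : R -> nat) : language :=
  Language vs_far ar.

Definition vs_fint (V : lmodType K) (f : vs_fun) :
    ('I_(vs_far f) -> V) -> V :=
  match f return ('I_(vs_far f) -> V) -> V with
  | VAdd => fun a => a ord0 + a ord_max
  | VZero => fun=> 0
  | VScal c => fun a => c *: a ord0
  end.

(* L_K, where the relation symbol n : nat stands for X^n *)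
Definition L_K : language := L_vs_with (fun _ : nat => 1%N).

(* L_{K-vs} together with the single predicate X *)
Definition L_X : language := L_vs_with (fun _ : unit => 1%N).

(** * The theories *)

(* L_K-structures whose reduct is a K-vector space (axiom (1)) *)
Record LK_space := LKSpace {
  space :> lmodType K;
  Xpow : nat -> set space }.

Definition LK_structure (M : LK_space) : structure L_K :=
  @Structure L_K M (@vs_fint M) (fun (n : nat) a => Xpow n (a ord0)).

Definition LX_structure (M : LK_space) : structure L_X :=
  @Structure L_X M (@vs_fint M) (fun _ a => Xpow 1 (a ord0)).

Definition linearly_independent (V : lmodType K) n (a : 'I_n -> V) : Prop :=
  forall c : 'I_n -> K, \sum_i c i *: a i = 0 -> forall i, c i = 0.

Definition span (V : lmodType K) (B : set V) : set V :=
  [set v | exists n (c : 'I_n -> K) (b : 'I_n -> V),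
     (forall i, B (b i)) /\ v = \sum_i c i *: b i].

Definition infinite_dimensional (V : lmodType K) (Y : set V) : Prop :=
  forall B : set V, finite_set B -> B `<=` Y -> span B <> Y.

Section Axes.
Variable M : LK_space.
Local Notation X := (@Xpow M 1).

Definition Xstar : set M := X `\ 0.

Definition parallel (x y : M) : Prop := X (x + y).

Definition parallel_equivalence : Prop :=
  [/\ forall x, Xstar x -> parallel x x,
      forall x y, Xstar x -> Xstar y -> parallel x y -> parallel y x
    & forall x y z, Xstar x -> Xstar y -> Xstar z ->
        parallel x y -> parallel y z -> parallel x z].

Definition axis : set (set M) :=
  [set Y | exists2 x, Xstar x &
     Y = [set y | Xstar y /\ parallel x y] `|` [set 0]].

End Axes.

(* Axiom (1) is part of LK_space; the conjuncts are axioms (2)-(6). *)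
Definition T_K (M : LK_space) : Prop :=
  [/\ forall (c : K) (x : M), Xpow 1 x -> Xpow 1 (c *: x),
      forall n (v : M), Xpow n v <->
        exists x : 'I_n -> M, (forall j, Xpow 1 (x j)) /\ v = \sum_j x j,
      parallel_equivalence M,
      infinite_set (@axis M)
    & forall n (Y : 'I_n.+1 -> set M) (a : 'I_n.+1 -> M),
        (forall i, axis (Y i)) -> injective Y ->
        (forall i, Y i (a i) /\ a i <> 0) ->
        linearly_independent a].

Definition T_K_inf (M : LK_space) : Prop :=
  T_K M /\ forall Y : set M, axis Y -> infinite_dimensional Y.

(* T_{K,oo} in the language L_{K-vs} together with X *)
Definition LX_models (S : structure L_X) : Prop :=
  exists2 M : LK_space, T_K_inf M & S = LX_structure M.

(** * Supports, projections and hulls *)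

Section Hull.
Variable M : LK_space.

(* S is an n-element set of pairwise nonparallel elements of X \ {0} with
   sum a, where a is in X^n \ X^(n-1) (in X^0 if n = 0). *)
Definition is_supp (a : M) (S : set M) : Prop :=
  exists n (m : 'I_n -> M),
    [/\ Xpow n a /\ ((0 < n)%N -> ~ Xpow n.-1 a),
        forall i, Xstar (m i),
        injective m /\ forall i j, i <> j -> ~ parallel (m i) (m j),
        a = \sum_i m i
      & S = range m].

Definition supp (a : M) : set M := xget set0 (is_supp a).

(* The (unique) element of supp a lying in Y if there is one, 0 otherwise. *)
Definition axis_proj (Y : set M) (a : M) : M := xget 0 (supp a `&` Y).

Definition axes (A : set M) : set (set M) :=
  [set Y | axis Y /\ axis_proj Y @` A <> [set 0]].

Definition hat (A : set M) : set M :=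
  span (\bigcup_(Y in axes A) (axis_proj Y @` A)).

End Hull.

(** * The predicates P_{k,n,i} *)

(* A finite L_K-structure on a K-vector space, taken up to isomorphism to be
   K^d, together with a (k+1)-tuple of elements. *)
Record hat_type (k : nat) := HatType {
  ht_dim : nat;
  ht_X : nat -> {set 'rV[K]_ht_dim};
  ht_pt : 'I_k.+1 -> 'rV[K]_ht_dim }.

(* The L_K-structure induced by M on the hull of <a_0, ..., a_k> has
   isomorphism type t.  If [marked] is true this is the isomorphism type of
   the hull with a_0, ..., a_k as distinguished elements; otherwise the tuple
   of t is ignored. *)
Definition has_hat_type (marked : bool) (M : LK_space) k
    (a : 'I_k.+1 -> M) (t : hat_type k) : Prop :=
  exists f : {linear 'rV[K]_(ht_dim t) -> M},
    [/\ injective f,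
        range f = hat (span (range a)),
        forall m u, Xpow m (f u) <-> u \in ht_X t m
      & marked -> forall j, f (ht_pt t j) = a j].

Definition P_holds (marked : bool) (M : LK_space) k (n : nat)
    (t : hat_type k) (a : 'I_k.+1 -> M) : Prop :=
  span (range a) `<=` Xpow n /\ has_hat_type marked a t.

Definition possible_type (marked : bool) k (n : nat) (t : hat_type k) : Prop :=
  exists2 M : LK_space, T_K_inf M &
  exists a : 'I_k.+1 -> M, P_holds marked n t a.

(* The symbols P_{k,n,i}; the index i is a representative of a possible
   isomorphism type, so a type may have several symbols with the same
   interpretation. *)
Record P_sym (marked : bool) := PSym {
  P_k : nat;
  P_n : nat;
  P_i : hat_type P_k;
  P_possible : possible_type marked P_n P_i }.

Definition P_ar marked (s : P_sym marked) : nat := (P_k s).+1.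

Definition P_int marked (M : LK_space) (s : P_sym marked)
    (a : 'I_(P_ar s) -> M) : Prop :=
  P_holds marked (P_n s) (P_i s) a.

(* L_K expanded by all the predicates P_{k,n,i} *)
Definition L_P (marked : bool) : language :=
  L_vs_with (fun r : nat + P_sym marked =>
    match r with inl _ => 1%N | inr s => P_ar s end).

Definition LP_rint marked (M : LK_space) (r : nat + P_sym marked) :
    ('I_(@rar (L_P marked) r) -> M) -> Prop :=
  match r return ('I_(@rar (L_P marked) r) -> M) -> Prop with
  | inl n => fun a => Xpow n (a ord0)
  | inr s => @P_int marked M s
  end.

Definition LP_structure marked (M : LK_space) : structure (L_P marked) :=
  @Structure (L_P marked) M (@vs_fint M) (@LP_rint marked M).

(* T_{K,oo} in the language L_P *)
Definition LP_models marked (S : structure (L_P marked)) : Prop :=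
  exists2 M : LK_space, T_K_inf M & S = LP_structure marked M.

Definition P_definable_LK marked (s : P_sym marked) : Prop :=
  exists phi : formula L_K (P_ar s), existential phi /\
  forall M : LK_space, T_K_inf M ->
  forall a : 'I_(P_ar s) -> M, P_int a <-> @sat L_K (LK_structure M) _ phi a.

Definition P_definable_LX marked (s : P_sym marked) : Prop :=
  exists phi : formula L_X (P_ar s), existential phi /\
  forall M : LK_space, T_K_inf M ->
  forall a : 'I_(P_ar s) -> M, P_int a <-> @sat L_X (LX_structure M) _ phi a.

End Languages.

(* Main.v *)
From HB Require Import structures.
Require Import Defs.
From mathcomp Require Import all_boot all_algebra.
From mathcomp Require Import mathcomp_extra boolp classical_sets functions.
From mathcomp Require Import cardinality.

(** In a model M of the theory every vector of F(M) is in exactly one way a sum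
of nonzero vectors on distinct axes: [pr x Y] is the coordinate of x on the
axis Y, [axsupp x] lists the axes with a nonzero coordinate, and X^n is the
set of vectors with at most n nonzero coordinates. The proof measures how
much of this a formula can see. Call [covered m f C] the property that the
vectors f t, for t in the finite set C, lie in F(M) and use at most m axes
altogether, and write [lin v u] for the combination of the tuple v with
coefficients u. Two tuples, possibly in different models, are r-equivalent
([equiv r]) when for every m < r and every set C of coefficient vectors the
combinations in C are covered by m axes for both tuples or for neither. As K
is finite, there are finitely many classes.

The heart is the back-and-forth step [equiv_push]: given r there is r' such
that if v and w are r'-equivalent, every vector a added to v is answered by
some b added to w keeping r-equivalence. If all vectors a + lin v u use at
least r axes, b is chosen generically. Otherwise a may be translated to a
vector on fewer than r axes. Let U be the space of those coefficients u such
that lin v u is supported on the axes of the combinations with at most 2r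
axes. On U all numbers of axes agree for v and w, and Moebius inversion
([perm_eq_supersets]) turns them into the multiset of kernels of the
coordinate maps on U. Hence the axes of v and of w on U can be matched so
that corresponding coordinate maps have equal kernels ([ex_matched]), and b is
built from a axis by axis ([matched_extend]): the axes are infinite
dimensional and infinitely many, so there is always room. Coefficients outside
U give vectors so long that adding a multiple of a or b leaves at least r
axes.

By induction every formula is invariant under some r-equivalence
([formula_invariant]), hence a boolean combination of the properties
[covered m (lin v) C] ([definable_invariant]). These are existential in the
language with X alone, the coordinates being the witnesses
([covered_pattern]). They are quantifier free with the predicates P: the
number of axes of a tuple is the least m such that X^m contains its hull,
which the isomorphism type of the hull records whether or not the tuple is
marked ([covered_possible], [P_holds_covered]). Finally the predicates P are
existential because a basis of the hull, its linear relations with the tuple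
and the trace of X on its span determine the isomorphism type of the hull
([P_pattern]). *)

Set Implicit Arguments.
Unset Strict Implicit.
Unset Printing Implicit Defensive.

Import GRing.Theory.
Local Open Scope classical_set_scope.
Local Open Scope ring_scope.

(** * Coordinates along the axes *)

Section Model.
Variables (K : finFieldType) (M : LK_space K).
Hypothesis TM : T_K M.
Implicit Types (x y z : M) (Y Z : set M) (s : seq (set M)) (c : set M -> M).

Lemma X_scale (a : K) x : Xpow 1 x -> Xpow 1 (a *: x).
Proof. by case: TM => h *; exact: h. Qed.

Lemma XpowE n x : Xpow n x <->
  exists m : 'I_n -> M, (forall j, Xpow 1 (m j)) /\ x = \sum_j m j.
Proof. by case: TM => _ h *; exact: h. Qed.

Lemma Xpow_sum n (m : 'I_n -> M) : (forall j, Xpow 1 (m j)) ->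
  Xpow n (\sum_j m j).
Proof. by move=> h; apply/XpowE; exists m. Qed.

Lemma Xpow0E x : Xpow 0 x <-> x = 0.
Proof.
split; first by case/XpowE => m [_ ->]; rewrite big_ord0.
by move=> ->; apply/XpowE; exists (fun=> 0); split=> [[]|]//; rewrite big_ord0.
Qed.

Lemma X_zero : Xpow 1 (0 : M).
Proof.
case: TM => _ _ _ h _; have [Y [x [Xx _] _]] := infinite_setN0 h.
by rewrite -(scale0r x); exact: X_scale.
Qed.

Definition ax x : set M := [set y | Xstar y /\ parallel x y] `|` [set 0].

Lemma axis_ax x : Xstar x -> axis (ax x).
Proof. by exists x. Qed.

Lemma parallel_refl x : Xstar x -> parallel x x.
Proof. by case: TM => _ _ [h _ _] _ _; apply: h. Qed.

Lemma parallel_sym x y : Xstar x -> Xstar y -> parallel x y -> parallel y x.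
Proof. by case: TM => _ _ [_ h _] _ _; apply: h. Qed.

Lemma parallel_trans x y z : Xstar x -> Xstar y -> Xstar z ->
  parallel x y -> parallel y z -> parallel x z.
Proof. by case: TM => _ _ [_ _ h] _ _; apply: h. Qed.

Lemma ax_self x : Xstar x -> ax x x.
Proof. by move=> h; left; split=> //; exact: parallel_refl. Qed.

Lemma ax_eq x y : Xstar x -> Xstar y -> parallel x y -> ax x = ax y.
Proof.
move=> hx hy xy; apply/seteqP; split=> z [[hz xz]|->]; try by right.
  by left; split=> //; apply: parallel_trans xz => //; apply: parallel_sym.
by left; split=> //; apply: parallel_trans xz.
Qed.

Lemma axis_eq Y x : axis Y -> Y x -> x <> 0 -> Y = ax x.
Proof. by move=> [y hy ->] [[hx yx]|//] _; apply: ax_eq. Qed.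

Lemma axis_Xstar Y x : axis Y -> Y x -> x <> 0 -> Xstar x.
Proof. by move=> [y hy ->] [[hx yx]|//]. Qed.

Lemma axis_zero Y : axis Y -> Y 0.
Proof. by move=> [y hy ->]; right. Qed.

Lemma axis_X Y x : axis Y -> Y x -> Xpow 1 x.
Proof.
move=> hY Yx; case: (pselect (x = 0)) => [->|x0]; last first.
  by case: (axis_Xstar hY Yx x0).
case: hY => y [Xy _] _; rewrite -(scale0r y); exact: X_scale.
Qed.

Lemma axis_parallel Y x y : axis Y -> Y x -> Y y -> Xpow 1 (x + y).
Proof.
move=> hY Yx Yy; case: (pselect (x = 0)) => [->|x0].
  by rewrite add0r; exact: axis_X Yy.
case: (pselect (y = 0)) => [->|y0]; first by rewrite addr0; exact: axis_X Yx.
move: Yy; rewrite (axis_eq hY Yx x0) => -[[_ ]//|/y0//].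
Qed.

Lemma axis_scale Y (a : K) x : axis Y -> Y x -> Y (a *: x).
Proof.
move=> hY Yx; case: (pselect (a *: x = 0)) => [->|ax0]; first exact: axis_zero.
have x0 : x <> 0 by move=> h; apply: ax0; rewrite h scaler0.
rewrite (axis_eq hY Yx x0); left; split; first split=> //.
  exact/X_scale/(axis_X hY).
by rewrite /parallel -{1}[x]scale1r -scalerDl; exact/X_scale/(axis_X hY).
Qed.

Lemma axis_add Y x y : axis Y -> Y x -> Y y -> Y (x + y).
Proof.
move=> hY Yx Yy.
case: (pselect (x + y = 0)) => [->|s0]; first exact: axis_zero.
case: (pselect (x = 0)) => [->|x0]; first by rewrite add0r.
rewrite {1}(axis_eq hY Yx x0); left; split; first split=> //.
  exact: axis_parallel hY Yx Yy.
rewrite /parallel addrA; apply: (axis_parallel hY _ Yy).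
by have := axis_scale (1 + 1) hY Yx; rewrite scalerDl scale1r.
Qed.

Lemma ax_inj Y Z x : axis Y -> axis Z -> Y x -> Z x -> x <> 0 -> Y = Z.
Proof.
by move=> hY hZ Yx Zx x0; rewrite (axis_eq hY Yx x0) (axis_eq hZ Zx x0).
Qed.

(** Independence of the axes, in the form used below: the nonzero summands
would be linearly dependent with all coefficients 1. *)
Lemma sum_axes_eq0 s c : uniq s -> (forall Y, Y \in s -> axis Y /\ Y (c Y)) ->
  \sum_(Y <- s) c Y = 0 -> forall Y, Y \in s -> c Y = 0.
Proof.
move=> us hs s0 Y Ys; apply/eqP/negPn/negP => cY.
pose t := filter (fun Y => c Y != 0) s.
have Yt : Y \in t by rewrite mem_filter cY.
have t0 : \sum_(Y <- t) c Y = 0.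
  rewrite big_filter -[RHS]s0 [RHS](bigID (fun Y => c Y != 0)) /=.
  by rewrite [X in _ + X]big1 ?addr0// => i /negPn/eqP.
have ut : uniq t by exact: filter_uniq.
have [n tn] : exists n, size t = n.+1 by case: (t) Yt => // ? l _;
  exists (size l).
have ht i : (i < n.+1)%N -> nth set0 t i \in t by move=> ?;
  rewrite mem_nth// tn.
have hts Z : Z \in t -> [/\ axis Z, Z (c Z) & c Z <> 0].
  by rewrite mem_filter => /andP[/eqP ? /hs[]].
have ind : linearly_independent (fun i : 'I_n.+1 => c (nth set0 t i)).
  case: TM => _ _ _ _ h; apply: (h n (fun i : 'I_n.+1 => nth set0 t i)).
  - by move=> i; case: (hts _ (ht i (ltn_ord i))).
  - move=> i j /eqP; rewrite nth_uniq ?tn// => /eqP; exact: val_inj.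
  - by move=> i; case: (hts _ (ht i (ltn_ord i))).
suff /eqP : (1 : K) = 0 by rewrite oner_eq0.
apply: (ind (fun=> 1) _ ord0).
under eq_bigr do rewrite scale1r.
by rewrite -[RHS]t0 [RHS](big_nth set0) tn big_mkord.
Qed.

Lemma sum_supported s s' c : uniq s -> uniq s' -> {subset s <= s'} ->
  (forall Y, Y \notin s -> c Y = 0) ->
  \sum_(Y <- s') c Y = \sum_(Y <- s) c Y.
Proof.
move=> us us' ss' h; rewrite (bigID (fun Y => Y \in s)) /=.
rewrite [X in _ + X]big1 ?addr0; last by move=> Y /h.
rewrite -big_filter; apply: perm_big; apply: uniq_perm => //.
  exact: filter_uniq.
move=> Y; rewrite mem_filter; case Ys: (Y \in s) => //=; exact: ss'.
Qed.

(** A representation of x as a sum over distinct axes; zero summands are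
allowed, so that two vectors can be given the same list of axes. *)
Definition decomp x s c := [/\ uniq s,
  forall Y, Y \in s -> axis Y /\ Y (c Y),
  forall Y, Y \notin s -> c Y = 0
  & x = \sum_(Y <- s) c Y].

Lemma decomp_sub s' x s c : decomp x s c -> {subset s <= s'} -> uniq s' ->
  (forall Y, Y \in s' -> axis Y) -> decomp x s' c.
Proof.
case=> us hs h xE ss us' ax'; split=> //.
- move=> Y Ys'; split; first exact: ax'.
  case: (boolP (Y \in s)) => [/hs[]//|/h ->]; by apply: axis_zero; exact: ax'.
- by move=> Y Ys'; apply: h; apply: contra Ys' => /ss.
by rewrite (sum_supported us us').
Qed.

Lemma decomp_common x s c y s' c' : decomp x s c -> decomp y s' c' ->
  exists2 t, decomp x t c & decomp y t c'.
Proof.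
move=> d d'; exists (undup (s ++ s')).
  apply: (decomp_sub d _ (undup_uniq _) _).
    by move=> Y Ys; rewrite mem_undup mem_cat Ys.
  move=> Y; rewrite mem_undup mem_cat.
  by case: d d' => [_ h _ _] [_ h' _ _] /orP[/h|/h'] [].
apply: (decomp_sub d' _ (undup_uniq _) _).
  by move=> Y Ys; rewrite mem_undup mem_cat Ys orbT.
move=> Y; rewrite mem_undup mem_cat.
by case: d d' => [_ h _ _] [_ h' _ _] /orP[/h|/h'] [].
Qed.

Lemma decomp_lin (a : K) x y s c c' : decomp x s c -> decomp y s c' ->
  decomp (a *: x + y) s (fun Y => a *: c Y + c' Y).
Proof.
move=> [us h h0 ->] [_ h' h0' ->]; split=> //.
- move=> Y Ys; have [hY cY] := h _ Ys; have [_ cY'] := h' _ Ys; split=> //.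
  by apply: axis_add => //; exact: axis_scale.
- by move=> Y Ys; rewrite h0// h0'// scaler0 addr0.
by rewrite scaler_sumr -big_split.
Qed.

(** The difference of two decompositions is one of 0 over a common list. *)
Lemma decomp_inj x s c s' c' : decomp x s c -> decomp x s' c' -> c = c'.
Proof.
move=> d d'; have [t dt dt'] := decomp_common d d'.
have [us h h0] := decomp_lin (- 1) dt dt'.
rewrite scaleN1r addNr => /esym s0; apply/funext => Y.
case: (boolP (Y \in t)) => [Yt|Yt]; last first.
  by case: dt => _ _ -> //; case: dt' => _ _ -> //.
have := sum_axes_eq0 us h s0 Yt.
by rewrite scaleN1r => /eqP; rewrite addrC subr_eq0 => /eqP.
Qed.

Lemma decomp_trim x s c : decomp x s c ->
  exists s', [/\ decomp x s' c, {subset s' <= s} &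
    forall Y, Y \in s' = (c Y != 0)].
Proof.
case=> us h h0 xE; pose s' := filter (fun Y => c Y != 0) s.
have sE Y : (Y \in s') = (c Y != 0).
  rewrite mem_filter; case: (boolP (Y \in s)); first by rewrite andbT.
  by move=> /h0 ->; rewrite eqxx.
have sub : {subset s' <= s} by move=> Y; rewrite mem_filter => /andP[].
have us' : uniq s' by exact: filter_uniq.
exists s'; split=> //; split=> //.
- by move=> Y /sub/h.
- by move=> Y; rewrite sE negbK => /eqP.
rewrite xE; apply: sum_supported => // Y; by rewrite sE negbK => /eqP.
Qed.

Lemma decomp_axis Y y : axis Y -> Y y ->
  decomp y [:: Y] (fun Z => if Z == Y then y else 0).
Proof.
move=> hY Yy; split=> //.
- by move=> Z; rewrite inE => /eqP ->; rewrite eqxx.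
- by move=> Z; rewrite inE => /negPf ->.
by rewrite big_seq1 eqxx.
Qed.

(** Summands on the same axis are merged, as axes are closed under addition;
conversely missing summands are replaced by 0. *)
Lemma Xpow_decomp n x : Xpow n x <->
  exists s c, decomp x s c /\ (size s <= n)%N.
Proof.
split.
  case/XpowE => m [hm ->] {x}; elim: n m hm => [|n IH] m hm.
    exists [::], (fun=> 0); split=> //; split=> //.
    by rewrite big_ord0 big_nil.
  rewrite big_ord_recl.
  have [s [c [d sn]]] := IH (fun i => m (lift ord0 i)) (fun i => hm _).
  case: (pselect (m ord0 = 0)) => [->|m0].
    by exists s, c; rewrite add0r; split=> //; exact: leqW.
  have Xm : Xstar (m ord0) by split=> //; exact: hm.
  pose Y := ax (m ord0).
  have dY := decomp_axis (axis_ax Xm) (ax_self Xm); rewrite -/Y in dY.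
  pose t := undup (Y :: s).
  have ht Z : Z \in t -> axis Z.
    rewrite mem_undup inE => /orP[/eqP ->|]; first exact: axis_ax.
    by case: d => _ h _ _ /h[].
  have dt : decomp (\sum_(i < n) m (lift ord0 i)) t c.
    apply: (decomp_sub d _ (undup_uniq _) ht).
    by move=> Z Zs; rewrite mem_undup inE Zs orbT.
  have dYt : decomp (m ord0) t (fun Z => if Z == Y then m ord0 else 0).
    apply: (decomp_sub dY _ (undup_uniq _) ht).
    by move=> Z; rewrite mem_seq1 => /eqP ->; rewrite mem_undup mem_head.
  have := decomp_lin 1 dYt dt; rewrite scale1r => dd.
  exists t; eexists; split; first exact: dd.
  exact: leq_trans (size_undup _) _.
case=> s [c [[us h h0 ->] sn]]; apply/XpowE.
exists (fun i : 'I_n => if (i < size s)%N then c (nth set0 s i) else 0).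
split=> [j|].
  case: ifP => js; last exact: X_zero.
  by have [hY cY] := h _ (mem_nth set0 js); exact: axis_X cY.
rewrite (big_nth set0) big_mkord -big_mkcond /=.
by rewrite (big_ord_widen _ (fun i => c (nth set0 s i)) sn).
Qed.

End Model.

Section Span.
Variables (K : finFieldType) (V : lmodType K).
Implicit Types (A B : set V) (x y : V).

Definition submod A := A 0 /\ forall (a : K) x y, A x -> A y -> A (a *: x + y).

Lemma submodD A x y : submod A -> A x -> A y -> A (x + y).
Proof. by move=> [_ h] Ax Ay; rewrite -[x]scale1r; exact: h. Qed.

Lemma submodZ A a x : submod A -> A x -> A (a *: x).
Proof. by move=> [h0 h] Ax; rewrite -[_ *: _]addr0; exact: h. Qed.

Lemma submod_sum A (I : Type) (r : seq I) (P : pred I) (f : I -> V) :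
  submod A -> (forall i, P i -> A (f i)) -> A (\sum_(i <- r | P i) f i).
Proof.
by move=> sA h; apply: big_ind => //; [case: sA|move=> *; exact: submodD].
Qed.

Lemma span_incl B : B `<=` Defs.span B.
Proof.
move=> x Bx; exists 1%N, (fun=> 1), (fun=> x); split=> //.
by rewrite big_ord1 scale1r.
Qed.

Lemma span_min A B : submod A -> B `<=` A -> Defs.span B `<=` A.
Proof.
move=> sA BA x [n [a [b [hb ->]]]]; apply: submod_sum => // i _.
by apply: submodZ => //; exact: BA.
Qed.

Lemma span_submod B : submod (Defs.span B).
Proof.
split.
  by exists 0%N, (fun=> 0), (fun=> 0); split=> [[]|]//; rewrite big_ord0.
move=> a _ _ [n [c [b [hb ->]]]] [n' [c' [b' [hb' ->]]]].
exists (n + n')%N.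
exists (fun i : 'I_(n + n') =>
  match fintype.split i with inl j => a * c j | inr j => c' j end).
exists (fun i : 'I_(n + n') =>
  match fintype.split i with inl j => b j | inr j => b' j end).
split=> [i|]; first by case: (fintype.split i).
rewrite big_split_ord /= scaler_sumr; congr (_ + _); apply: eq_bigr => i _.
  by rewrite -[lshift _ _]/(unsplit (inl i)) unsplitK scalerA.
by rewrite -[rshift _ _]/(unsplit (inr i)) unsplitK.
Qed.

Lemma span_mono A B : A `<=` Defs.span B -> Defs.span A `<=` Defs.span B.
Proof. by move=> h; apply: span_min => //; exact: span_submod. Qed.

End Span.

Section Coordinates.
Variables (K : finFieldType) (M : LK_space K).
Implicit Types (x y z : M) (Y Z : set M) (s : seq (set M)) (c : set M -> M).

(** The decomposition of x without zero summands; the coordinates are all 0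
when x lies outside F(M). *)
Definition coords x : seq (set M) * (set M -> M) :=
  if pselect (exists p : seq (set M) * (set M -> M),
    decomp x p.1 p.2 /\ forall Y, (Y \in p.1) = (p.2 Y != 0)) is left h
  then projT1 (cid h) else ([::], fun=> 0).

Definition axsupp x := (coords x).1.
Definition pr x Y := (coords x).2 Y.

Definition inF x := exists n, Xpow n x.

Lemma mem_axsupp x Y : (Y \in axsupp x) = (pr x Y != 0).
Proof.
rewrite /axsupp /pr /coords; case: pselect => [h|_] /=; last by rewrite eqxx.
by case: (cid h) => p [].
Qed.

Lemma axsupp_uniq x : uniq (axsupp x).
Proof. by rewrite /axsupp /coords; case: pselect => // h;
  case: (cid h) => p [[]]. Qed.

Lemma axsupp_axis x Y : Y \in axsupp x -> axis Y.
Proof.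
rewrite /axsupp /coords; case: pselect => // h;
  case: (cid h) => p /= [[_ h1 _ _] _].
by move/h1 => [].
Qed.

Hypothesis TM : T_K M.

Lemma decompP x s c : decomp x s c -> inF x /\ pr x = c.
Proof.
move=> d; split; first by exists (size s); apply/(Xpow_decomp TM); exists s, c.
have [s' [d' _ hs]] := decomp_trim d.
rewrite /pr /coords; case: pselect => [h|[]]; last by exists (s', c).
by case: (cid h) => p /= [dp _]; exact: (decomp_inj TM dp d).
Qed.

Lemma inF_decomp x : inF x -> decomp x (axsupp x) (pr x).
Proof.
move=> [n] /(Xpow_decomp TM)[s [c [d _]]].
have [s' [d' _ hs]] := decomp_trim d.
rewrite /pr /axsupp /coords; case: pselect => [h|[]]; last by exists (s', c).
by case: (cid h) => p /= [dp _].
Qed.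

(** Uniqueness of coordinates: any decomposition computes them. *)
Lemma prE x s c Y : decomp x s c -> pr x Y = c Y.
Proof. by move=> /decompP[_ ->]. Qed.

Lemma pr_notin x Y : ~ inF x -> pr x Y = 0.
Proof.
move=> nx; rewrite /pr /coords; case: pselect => // h;
  case: (cid h) => p /= [dp _].
by case: nx; have [] := decompP dp.
Qed.

Lemma XpowP n x : Xpow n x <-> inF x /\ (size (axsupp x) <= n)%N.
Proof.
split=> [Xx|[Fx sn]]; last first.
  by apply/(Xpow_decomp TM); exists (axsupp x), (pr x); split=> //;
    exact: inF_decomp.
split; first by exists n.
case/(Xpow_decomp TM): Xx => s [c [d sn]].
apply: leq_trans sn; apply: uniq_leq_size; first exact: axsupp_uniq.
move=> Y; rewrite mem_axsupp (prE _ d); apply: contraR => Ys.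
by case: d => _ _ ->.
Qed.

Lemma Xpow_mono m n x : (m <= n)%N -> Xpow m x -> Xpow n x.
Proof. by move=> mn /XpowP[Fx h]; apply/XpowP; split=> //;
  exact: leq_trans mn. Qed.

Lemma pr_in x Y : axis Y -> Y (pr x Y).
Proof.
move=> hY; case: (boolP (Y \in axsupp x)) => Ys; last first.
  by move: Ys; rewrite mem_axsupp negbK => /eqP ->; exact: axis_zero.
case: (pselect (inF x)) => [/inF_decomp[_ /(_ _ Ys)[]]//|/(@pr_notin _ Y) p0].
by move: Ys; rewrite mem_axsupp p0 eqxx.
Qed.

Lemma pr_neq0 x Y : pr x Y <> 0 -> axis Y.
Proof. by move=> /eqP; rewrite -mem_axsupp => /axsupp_axis. Qed.

Lemma pr_X x Y : Xpow 1 (pr x Y).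
Proof.
case: (pselect (pr x Y = 0)) => [->|h]; first exact: X_zero.
by have hY := pr_neq0 h; exact: (axis_X TM hY (pr_in x hY)).
Qed.

Lemma decomp_linF (a : K) x y : inF x -> inF y ->
  exists s, decomp (a *: x + y) s (fun Y => a *: pr x Y + pr y Y).
Proof.
move=> /inF_decomp dx /inF_decomp dy; have [s d d'] := decomp_common dx dy.
by exists s; exact: decomp_lin.
Qed.

Lemma pr_lin (a : K) x y Y : inF x -> inF y ->
  pr (a *: x + y) Y = a *: pr x Y + pr y Y.
Proof. by move=> Fx Fy; have [s d] := decomp_linF a Fx Fy;
  rewrite (prE _ d). Qed.

Lemma inF0 : inF 0.
Proof. by exists 0%N; apply/(Xpow0E TM). Qed.

Lemma inF_submod : submod inF.
Proof.
split; first exact: inF0.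
by move=> a x y Fx Fy; have [s /decompP[]] := decomp_linF a Fx Fy.
Qed.

Lemma prD x y Y : inF x -> inF y -> pr (x + y) Y = pr x Y + pr y Y.
Proof. by move=> Fx Fy; rewrite -{1}[x]scale1r pr_lin// scale1r. Qed.

Lemma pr0 Y : pr 0 Y = 0.
Proof. by apply: (addrI (pr 0 Y)); rewrite -prD ?addr0//; exact: inF0. Qed.

Lemma prZ (a : K) x Y : inF x -> pr (a *: x) Y = a *: pr x Y.
Proof. by move=> Fx; rewrite -[_ *: x]addr0 pr_lin ?pr0 ?addr0//;
  exact: inF0. Qed.

Lemma pr_sum (I : Type) (r : seq I) (f : I -> M) Y : (forall i, inF (f i)) ->
  pr (\sum_(i <- r) f i) Y = \sum_(i <- r) pr (f i) Y.
Proof.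
move=> Ff; elim: r => [|i r IH]; first by rewrite !big_nil pr0.
rewrite !big_cons prD ?IH//; apply: submod_sum => //; exact: inF_submod.
Qed.

Lemma sum_pr x : inF x -> x = \sum_(Y <- axsupp x) pr x Y.
Proof. by case/inF_decomp. Qed.

Lemma X_inF x : Xpow 1 x -> inF x.
Proof. by exists 1%N. Qed.

Lemma pr_axis Y y Z : axis Y -> Y y -> pr y Z = if Z == Y then y else 0.
Proof. by move=> hY Yy; rewrite (prE _ (decomp_axis hY Yy)). Qed.

(** ** Supports and hulls *)

(** The families of which [is_supp] takes the range; the conditions on X^n and
injectivity there follow from these two. *)
Definition nonparallel n (m : 'I_n -> M) := (forall i, Xstar (m i)) /\
  forall i j, i <> j -> ~ parallel (m i) (m j).

Section Nonparallel.
Variables (n : nat) (m : 'I_n -> M).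
Hypothesis hm : nonparallel m.

Lemma nonparallel_ax_inj : injective (fun i => ax (m i)).
Proof.
case: hm => Xm pm i j ij; case: (eqVneq i j) => // /eqP /pm; case.
have := ax_self TM (Xm j); rewrite -ij => -[[]//|].
by case: (Xm j) => _ /[swap] ->; case.
Qed.

Lemma nonparallel_inF : inF (\sum_i m i).
Proof. by exists n; apply: Xpow_sum => // i; case: hm => /(_ i)[]. Qed.

Lemma nonparallel_pr Z : pr (\sum_i m i) Z =
  \sum_i if Z == ax (m i) then m i else 0.
Proof.
case: hm => Xm _; rewrite pr_sum => [|i]; last by apply: X_inF; case: (Xm i).
by apply: eq_bigr => i _; apply: pr_axis; [exact: axis_ax|exact: ax_self].
Qed.

Lemma nonparallel_pr_ax j : pr (\sum_i m i) (ax (m j)) = m j.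
Proof.
rewrite nonparallel_pr (bigD1 j)//= eqxx big1 ?addr0// => i ij.
by case: eqP => // /nonparallel_ax_inj ji; rewrite ji eqxx in ij.
Qed.

Lemma nonparallel_pr_neq0 Z : pr (\sum_i m i) Z <> 0 -> exists i, Z = ax (m i).
Proof.
move=> h; apply: contrapT => hn; apply: h.
rewrite nonparallel_pr big1// => i _; case: eqP => // ZE; case: hn; by exists i.
Qed.

Lemma nonparallel_axsupp : perm_eq (axsupp (\sum_i m i)) [seq ax (m i) | i <-
    enum 'I_n].
Proof.
apply: uniq_perm; first exact: axsupp_uniq.
  by rewrite map_inj_uniq ?enum_uniq//; exact: nonparallel_ax_inj.
move=> Z; apply/idP/mapP.
  rewrite mem_axsupp => /eqP /nonparallel_pr_neq0[i ->]; exists i => //.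
  exact: mem_enum.
move=> [i _ ->]; rewrite mem_axsupp nonparallel_pr_ax.
by case: hm => /(_ i)[_ /eqP].
Qed.

Lemma nonparallel_Xpow k : Xpow k (\sum_i m i) <-> (n <= k)%N.
Proof.
split=> [/XpowP[_]|nk]; last first.
  by apply/XpowP; split; [exact: nonparallel_inF|];
    rewrite (perm_size nonparallel_axsupp) size_map size_enum_ord.
by rewrite (perm_size nonparallel_axsupp) size_map size_enum_ord.
Qed.

Lemma nonparallel_range y : range m y <-> y <> 0 /\ exists Y, y = pr (\sum_i m
    i) Y.
Proof.
case: (hm) => Xm _; split=> [[i _ <-]|[y0 [Y yE]]].
  by split; [case: (Xm i)|exists (ax (m i)); rewrite nonparallel_pr_ax].
rewrite yE in y0 *; have [i ->] := nonparallel_pr_neq0 y0.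
by exists i => //; rewrite nonparallel_pr_ax.
Qed.

Lemma nonparallel_is_supp : is_supp (\sum_i m i) (range m).
Proof.
exists n, m; case: (hm) => Xm pm; split=> //.
  split; first exact/nonparallel_Xpow.
  by case: n m hm nonparallel_Xpow => // n' ? ? h _ /h; rewrite ltnn.
by split=> // i j ij; apply: nonparallel_ax_inj; rewrite /= ij.
Qed.

End Nonparallel.

Lemma ex_nonparallel x : inF x -> exists n (m : 'I_n -> M),
  [/\ nonparallel m, x = \sum_i m i & forall i, exists2 Y, Y \in axsupp x & m i
    = pr x Y].
Proof.
move=> Fx; pose Y (i : 'I_(size (axsupp x))) := nth set0 (axsupp x) i.
have Ys i : Y i \in axsupp x by exact: mem_nth.
exists (size (axsupp x)), (fun i => pr x (Y i)).
have hX i : Xstar (pr x (Y i)).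
  by split; [exact: pr_X|apply/eqP; rewrite -mem_axsupp].
split; [split=> // i j ij pij| |by move=> i; exists (Y i)].
- apply: ij; apply: val_inj; apply/eqP; rewrite -(nth_uniq set0 (ltn_ord i)
    (ltn_ord j) (axsupp_uniq x)).
  have hi := axsupp_axis (Ys i); have hj := axsupp_axis (Ys j).
  rewrite -/(Y i) -/(Y j).
  have [[_ i0] [_ j0]] := (hX i, hX j).
  rewrite (axis_eq TM hi (pr_in x hi) i0) (axis_eq TM hj (pr_in x hj) j0).
  by apply/eqP; apply: ax_eq.
by apply: (etrans (sum_pr Fx)); rewrite (big_nth set0) big_mkord.
Qed.

Lemma suppE x y : inF x -> supp x y <-> y <> 0 /\ exists Y, y = pr x Y.
Proof.
move=> Fx; have [n [m [hm xE _]]] := ex_nonparallel Fx.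
suff -> : supp x = range m by rewrite xE; exact: nonparallel_range.
rewrite /supp; case: xgetP => [S SE [n' [m' [_ Xm' [_ pm'] xE' ->]]]|/(_ (range
  m))[]].
  have hm' : nonparallel m' by [].
  apply/seteqP; split=> z; rewrite !(nonparallel_range) //; by rewrite -xE -xE'.
by rewrite xE; exact: nonparallel_is_supp.
Qed.

Lemma supp_notin x : ~ inF x -> supp x = set0.
Proof.
move=> nF; rewrite /supp; case: xgetP => // S _ [n [m [[Xx _] _ _ _ _]]].
by case: nF; exists n.
Qed.

Lemma supp_pr x y : supp x y -> exists2 Y, axis Y & y = pr x Y.
Proof.
case: (pselect (inF x)) => Fx; last by rewrite supp_notin.
by move=> /(suppE _ Fx)[y0 [Y yE]]; exists Y => //; apply: (@pr_neq0 x);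
  rewrite -yE.
Qed.

Lemma pr_supp x Y : pr x Y <> 0 -> supp x (pr x Y).
Proof.
move=> h; case: (pselect (inF x)) => Fx; last by case: h; exact: pr_notin.
by apply/suppE => //; split=> //; exists Y.
Qed.

Lemma axis_projE Y x : axis Y -> axis_proj Y x = pr x Y.
Proof.
move=> hY; rewrite /axis_proj; case: xgetP => [y _ [sy Yy]|h].
  have [Z hZ yE] := supp_pr sy.
  have y0 : y <> 0.
    case: (pselect (inF x)) => [Fx|/supp_notin s0]; last by rewrite s0 in sy.
    by case/(suppE _ Fx): sy.
  have Zy : Z y by rewrite yE; exact: pr_in.
  by rewrite (ax_inj TM hY hZ Yy Zy y0).
case: (pselect (pr x Y = 0)) => // p0.
by case: (h (pr x Y)); split; [exact: pr_supp|exact: pr_in].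
Qed.

Lemma supp_neq0 x y : supp x y -> y <> 0.
Proof.
case: (pselect (inF x)) => [Fx /(suppE _ Fx)[]//|/supp_notin ->//].
Qed.

(** The projections that are 0, and the axes on which all of A projects to 0,
contribute nothing to the span, so the hull is spanned by the supports. *)
Lemma hatE (A : set M) : hat A = Defs.span [set y | exists2 x, A x & supp x y].
Proof.
apply/seteqP; split; apply: span_mono.
  move=> _ [Y [hY _] [x Ax <-]]; rewrite axis_projE//.
  case: (pselect (pr x Y = 0)) => [->|p0]; first by case: (span_submod
    [set y | exists2 x, A x & supp x y]).
  by apply: span_incl; exists x => //; exact: pr_supp.
move=> y [x Ax sy]; have [Y hY yE] := supp_pr sy; apply: span_incl.
have im : (axis_proj Y @` A) y by exists x => //; rewrite axis_projE.
exists Y => //; split=> // AE; rewrite AE in im; exact: supp_neq0 sy im.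
Qed.

End Coordinates.

(** * Covers by finitely many axes *)

Section Cover.
Variables (K : finFieldType) (M : LK_space K).
Implicit Types (s : seq (set M)) (Y : set M).

Definition covered k (T : finType) (f : T -> M) (C : {set T}) : Prop :=
  exists s, (size s <= k)%N /\
    forall t, t \in C -> inF (f t) /\ {subset axsupp (f t) <= s}.

Lemma covered_mono k l (T : finType) (f : T -> M) (C D : {set T}) :
  (k <= l)%N -> C \subset D -> covered k f D -> covered l f C.
Proof.
move=> kl /fintype.subsetP CD [s [sk h]]; exists s; split;
  first exact: leq_trans kl.
by move=> t /CD /h.
Qed.

Lemma covered_ext k (T : finType) (f g : T -> M) (C : {set T}) :
  (forall t, t \in C -> f t = g t) -> covered k f C <-> covered k g C.
Proof.
move=> fg; split=> -[s [sk h]]; exists s; split=> // t tC.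
  by rewrite -fg//; exact: h.
by rewrite fg//; exact: h.
Qed.

Lemma covered_imset k (T T' : finType) (h : T' -> T) (f : T -> M) (C : {set
    T'}) :
  covered k (fun t => f (h t)) C <-> covered k f (h @: C).
Proof.
split=> -[s [sk hs]]; exists s; split=> // t.
  by case/imsetP => t' t'C ->; exact: hs.
by move=> tC; apply: hs; exact: imset_f.
Qed.

Lemma covered_inF k (T : finType) (f : T -> M) (C : {set T}) t :
  covered k f C -> t \in C -> inF (f t).
Proof. by move=> [s [_ h]] /h[]. Qed.

(* The axes on which some f t, t in C, has a nonzero coordinate. *)
Definition used_axes (T : finType) (f : T -> M) (C : {set T}) : seq (set M) :=
  undup (flatten [seq axsupp (f t) | t <- enum C]).

Lemma used_axes_uniq (T : finType) (f : T -> M) (C : {set T}) : uniq (used_axes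
    f C).
Proof. exact: undup_uniq. Qed.

Lemma mem_used_axesP (T : finType) (f : T -> M) (C : {set T}) Y :
  reflect (exists2 t, t \in C & pr (f t) Y != 0) (Y \in used_axes f C).
Proof.
rewrite mem_undup; apply: (iffP flatten_mapP) => -[t]; rewrite ?mem_enum => tC.
  by rewrite mem_axsupp => h; exists t.
by exists t; rewrite ?mem_enum ?mem_axsupp.
Qed.

Lemma used_axes_axis (T : finType) (f : T -> M) (C : {set T}) Y :
  Y \in used_axes f C -> axis Y.
Proof. by case/mem_used_axesP => t _; rewrite -mem_axsupp => /axsupp_axis. Qed.

Lemma coveredP k (T : finType) (f : T -> M) (C : {set T}) :
  (forall t, t \in C -> inF (f t)) ->
  covered k f C <-> (size (used_axes f C) <= k)%N.
Proof.
move=> Ff; split=> [[s [sk h]]|sk].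
  apply: leq_trans sk; apply: uniq_leq_size; first exact: used_axes_uniq.
  by move=> Y /mem_used_axesP[t tC]; rewrite -mem_axsupp; have [_] := h t tC;
    apply.
exists (used_axes f C); split=> // t tC; split; first exact: Ff.
by move=> Y Yt; apply/mem_used_axesP; exists t; rewrite // -mem_axsupp.
Qed.

Hypothesis TM : T_K M.

(** For a single vector the number of axes is the weight measured by X^k. *)
Lemma covered1 k (T : finType) (f : T -> M) t :
  covered k f [set t] <-> Xpow k (f t).
Proof.
split=> [[s [sk h]]|/(XpowP TM)[Ft sk]].
  have [Ft sub] := h t (finset.set11 t); apply/(XpowP TM); split=> //.
  by apply: leq_trans sk; apply: uniq_leq_size => //; exact: axsupp_uniq.
exists (axsupp (f t)); split=> // u; rewrite finset.in_set1 => /eqP ->;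
  by split.
Qed.

Lemma covered_Xpow k (T : finType) (f : T -> M) (C : {set T}) t :
  covered k f C -> t \in C -> Xpow k (f t).
Proof.
move=> h tC; apply/(covered1 _ f); apply: covered_mono h => //.
by rewrite finset.sub1set.
Qed.

Lemma Xpow_lin k l (a : K) (x y : M) :
  Xpow k x -> Xpow l y -> Xpow (k + l) (y + a *: x).
Proof.
case/(XpowE TM) => m [hm ->]; case/(XpowE TM) => m' [hm' ->].
rewrite addrC; apply/(XpowE TM).
exists (fun i : 'I_(k + l) =>
  match fintype.split i with inl j => a *: m j | inr j => m' j end).
split=> [i|]; first by case: (fintype.split i) => j //; exact: X_scale.
rewrite big_split_ord /= scaler_sumr; congr (_ + _); apply: eq_bigr => i _.
  by rewrite -[lshift _ _]/(unsplit (inl i)) unsplitK.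
by rewrite -[rshift _ _]/(unsplit (inr i)) unsplitK.
Qed.

Lemma fresh_axes s k : exists t, [/\ uniq t, size t = k,
  forall Y, Y \in t -> axis Y & forall Y, Y \in t -> Y \notin s].
Proof.
elim: k => [|k [t [ut st axt ts]]]; first by exists [::].
case: TM => _ _ _ inf _.
have [Y [hY nY]] := infinite_setN0 (infinite_setD inf (finite_seq (t ++ s))).
have {}nY : Y \notin t ++ s by apply/negP => h; exact: nY.
move: nY; rewrite mem_cat => /norP[nt ns]; exists (Y :: t); split=> //=.
- by rewrite nt.
- by rewrite st.
- by move=> Z; rewrite inE => /orP[/eqP ->|/axt].
- by move=> Z; rewrite inE => /orP[/eqP ->|/ts].
Qed.

End Cover.

(** Axes are infinite dimensional, and a finite set spans a subspace of finite
dimension. *)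
Lemma axis_avoid (K : finFieldType) (M : LK_space K) (Y : set M) (B : seq M) :
  T_K_inf M -> axis Y -> (forall b, b \in B -> Y b) ->
  exists2 z, Y z & z \notin B.
Proof.
move=> [TM inf] hY BY; apply: contrapT => h.
apply: (inf Y hY [set` B] (finite_seq B)) => //.
apply/seteqP; split.
  apply: span_min => //; split; first exact: axis_zero.
  by move=> a x y Yx Yy; apply: axis_add => //; exact: axis_scale.
move=> z Yz; apply: span_incl => /=; apply: contrapT => /negP zB.
by apply: h; exists z.
Qed.

(** * Matching two families of vectors axis by axis *)

Section Counting.
Variable T : finType.

Lemma count_sum (S : finType) (a : pred S) (s : seq S) :
  count a s = (\sum_(D | a D) count_mem D s)%N.
Proof.
elim: s => [|x s IH] /=; first by rewrite big1.
rewrite big_split /= -IH; congr addn.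
rewrite big_mkcond (bigD1 x)//= eqxx big1 ?addn0; first by case: (a x).
by move=> D /negPf Dx; rewrite eq_sym Dx; case: (a D).
Qed.

(** Moebius inversion: the number of occurrences of C is the number of
supersets of C minus the occurrences of strict supersets, known by induction. *)
Lemma perm_eq_supersets (xs ys : seq {set T}) :
  (forall C : {set T}, count (fun W : {set T} => C \subset W) xs =
                       count (fun W : {set T} => C \subset W) ys) ->
  perm_eq xs ys.
Proof.
move=> h; apply/allP => C _ /=; apply/eqP.
have [n] := ubnP #|~: C|; elim: n C => // n IH C; rewrite ltnS => Cn.
have := h C; rewrite [in LHS]count_sum [in RHS]count_sum.
rewrite (bigD1 C)//= [in RHS](bigD1 C)//= => e.
apply: (@addIn (\sum_(D : {set T} | (C \subset D) && (D != C)) count_mem D ys)).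
rewrite -e; congr addn; apply: eq_bigr => D /andP[CD DC].
apply/esym; apply: IH; apply: leq_trans Cn.
by apply: proper_card; rewrite finset.properC finset.properEneq eq_sym DC.
Qed.

Lemma perm_eq_map (A B C : eqType) (f : A -> C) (g : B -> C) s t :
  perm_eq (map f s) (map g t) ->
  exists2 t', perm_eq t' t & map f s = map g t'.
Proof.
case: t => [|b t].
  move=> /perm_size /=; rewrite size_map; case: s => // _.
  by exists [::].
move=> /(perm_iotaP (g b))[Is pI E]; rewrite size_map in pI.
exists (map (nth b (b :: t)) Is).
  by apply/(perm_iotaP b); exists Is.
rewrite E -map_comp; apply/eq_in_map => i; rewrite (perm_mem pI) mem_iota.
by move=> ilt; rewrite (nth_map b).
Qed.

End Counting.

Section Matching.
Variables (K : finFieldType) (M N : LK_space K) (T : finType).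
Implicit Types (f : T -> M) (g : T -> N) (U C : {set T}).

(** The i-th axes of sa and sb correspond to each other: on U the coordinates
of f and g along them vanish simultaneously. *)
Definition matched U f g (sa : seq (set M)) (sb : seq (set N)) :=
  [/\ size sa = size sb, uniq sa /\ uniq sb,
      (forall Y, Y \in sa -> axis Y) /\ (forall Z, Z \in sb -> axis Z)
    & forall u, u \in U ->
      [/\ inF (f u) /\ inF (g u),
          {subset axsupp (f u) <= sa} /\ {subset axsupp (g u) <= sb}
        & forall i, (i < size sa)%N ->
          pr (f u) (nth set0 sa i) = 0 <-> pr (g u) (nth set0 sb i) = 0]].

Let W (L : LK_space K) U (f : T -> L) (Y : set L) : {set T} :=
  [set u in U | pr (f u) Y == 0].

(** The axes used by C are those whose coordinate does not vanish on all of C,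
so numbers of axes count the kernels that contain C. *)
Lemma count_kernels (L : LK_space K) U C (f : T -> L) : C \subset U ->
  (count (fun Y => C \subset W U f Y) (used_axes f U) +
    size (used_axes f C))%N = size (used_axes f U).
Proof.
move=> CU; rewrite -[RHS](count_predC (fun Y => C \subset W U f Y)); congr addn.
rewrite -size_filter; apply: perm_size; apply: uniq_perm;
  first exact: used_axes_uniq.
  exact/filter_uniq/used_axes_uniq.
move=> Y; rewrite mem_filter /=; apply/mem_used_axesP/andP.
  case=> t tC nz; split; last first.
    by apply/mem_used_axesP; exists t => //; exact: (fintype.subsetP CU).
  by apply: contra nz => /fintype.subsetP/(_ _ tC); rewrite inE => /andP[].
case=> /fintype.subsetPn[t tC nz] _; exists t => //; apply: contra nz => z.
by rewrite inE z andbT (fintype.subsetP CU).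
Qed.

(** The numbers of axes used by subsets of U determine the kernels of the
coordinate maps on U with multiplicity, hence a bijection between the axes. *)
Lemma ex_matched U f g :
  (forall u, u \in U -> inF (f u) /\ inF (g u)) ->
  (forall C k, C \subset U -> covered k f C <-> covered k g C) ->
  exists sa sb, matched U f g sa sb.
Proof.
move=> FU h.
have sizeE C : C \subset U -> size (used_axes f C) = size (used_axes g C).
  move=> CU.
  have FC t : t \in C -> inF (f t) by move=> /(fintype.subsetP CU)/FU[].
  have GC t : t \in C -> inF (g t) by move=> /(fintype.subsetP CU)/FU[].
  apply/eqP; rewrite eqn_leq; apply/andP; split.
    by apply/(coveredP _ FC)/h => //; apply/(coveredP _ GC).
  by apply/(coveredP _ GC)/h => //; apply/(coveredP _ FC).
have : perm_eq (map (W U f) (used_axes f U)) (map (W U g) (used_axes g U)).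
  apply: perm_eq_supersets => C; rewrite !count_map /=.
  case: (boolP (C \subset U)) => CU.
    apply: (@addIn (size (used_axes f C))); rewrite (count_kernels f CU).
    by rewrite (sizeE _ CU) (count_kernels g CU) sizeE.
  have nW (L : LK_space K) (e : T -> L) Y : (C \subset W U e Y) = false.
    apply: contraNF CU => /fintype.subset_trans; apply.
    by apply/fintype.subsetP => t; rewrite inE => /andP[].
  by rewrite !(eq_count (nW _ _)) !count_pred0.
move=> /perm_eq_map[sb pb E]; exists (used_axes f U), sb.
have sE : size (used_axes f U) = size sb.
  by have := congr1 size E; rewrite !size_map.
split=> //.
- by split; [exact: used_axes_uniq|rewrite (perm_uniq pb) used_axes_uniq].
- by split=> Y; [|rewrite (perm_mem pb)] => /used_axes_axis.
move=> u uU; split; first exact: FU.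
  split=> Y; rewrite ?(perm_mem pb) mem_axsupp => nz; apply/mem_used_axesP;
    by exists u.
move=> i isa; have := congr1 (nth finset.set0 ^~ i) E.
rewrite (nth_map set0)// (nth_map set0) -?sE// => /finset.setP/(_ u).
by rewrite !inE uU /= => e; split=> /eqP z; apply/eqP; [rewrite -e|rewrite e].
Qed.

End Matching.

Lemma matched_sym (K : finFieldType) (M N : LK_space K) (T : finType)
    (U : {set T}) (f : T -> M) (g : T -> N) sa sb :
  matched U f g sa sb -> matched U g f sb sa.
Proof.
case=> sE [ua ub] [xa xb] h; split=> // u /h[[Fu Gu] [sua sub] hi].
by split=> // i; rewrite -sE => /hi hh; split=> /hh.
Qed.

(** An axis of g used by C corresponds to an axis of f used by C. *)
Lemma matched_covered (K : finFieldType) (M N : LK_space K) (T : finType)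
    (U C : {set T}) (f : T -> M) (g : T -> N) sa sb k :
  matched U f g sa sb -> C \subset U -> covered k f C <-> covered k g C.
Proof.
move: M N f g sa sb.
suff h (M N : LK_space K) (f : T -> M) (g : T -> N) sa sb :
    matched U f g sa sb -> C \subset U -> covered k f C -> covered k g C.
  move=> M N f g sa sb m CU; split; first exact: (h _ _ _ _ _ _ m CU).
  exact: (h _ _ _ _ _ _ (matched_sym m) CU).
case=> sE [ua ub] [xa xb] h CU.
have hC t : t \in C -> _ := fun tC => h t (fintype.subsetP CU t tC).
have FC t : t \in C -> inF (f t) by move=> /hC[[]].
have GC t : t \in C -> inF (g t) by move=> /hC[[]].
move=> /(coveredP _ FC) sk; apply/(coveredP _ GC); apply: leq_trans sk.
have axg Z : Z \in used_axes g C -> Z \in sb.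
  by case/mem_used_axesP => t /hC[_ [_ sb'] _]; rewrite -mem_axsupp => /sb'.
rewrite -(size_map (fun Z => nth set0 sa (index Z sb))); apply: uniq_leq_size.
  rewrite map_inj_in_uniq ?used_axes_uniq// => Y Z /axg Ys /axg Zs /eqP.
  rewrite nth_uniq ?sE ?index_mem// => /eqP e.
  by rewrite -(nth_index set0 Ys) e nth_index.
move=> _ /mapP[Z Zg ->]; have Zs := axg _ Zg;
  case/mem_used_axesP: Zg => t tC nz.
apply/mem_used_axesP; exists t => //; apply: contra nz => /eqP.
case: (hC _ tC) => _ _ /(_ (index Z sb)); rewrite sE index_mem => /(_ Zs) e.
by move/e; rewrite nth_index// => ->.
Qed.

(** * The back-and-forth step *)

Definition lin (K : finFieldType) (V : lmodType K) n (v : 'I_n -> V)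
  (u : 'rV[K]_n) : V := \sum_i u ord0 i *: v i.

Lemma lin_is_linear (K : finFieldType) (V : lmodType K) n (v : 'I_n -> V) :
  linear (lin v).
Proof.
move=> a x y; rewrite /lin scaler_sumr -big_split; apply: eq_bigr => i _.
by rewrite !mxE scalerDl scalerA.
Qed.

HB.instance Definition _ (K : finFieldType) (V : lmodType K) n
    (v : 'I_n -> V) := GRing.isLinear.Build K 'rV[K]_n V *:%R (lin v)
      (lin_is_linear v).

Section Extension.
Variables (K : finFieldType) (M N : LK_space K) (n : nat).
Hypotheses (TM : T_K M) (TN : T_K_inf N).
Variables (f : {linear 'rV[K]_n -> M}) (g : {linear 'rV[K]_n -> N}).
Variable U : {set 'rV[K]_n}.
Hypotheses (U0 : 0 \in U)
  (UL : forall a x y, x \in U -> y \in U -> a *: x + y \in U).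

Let UZ a x : x \in U -> a *: x \in U.
Proof. by move=> xU; rewrite -[_ *: _]addr0; exact: UL. Qed.

Let UD x y : x \in U -> y \in U -> x + y \in U.
Proof. by move=> xU yU; rewrite -[x]scale1r; exact: UL. Qed.

Let TN' : T_K N := TN.1.

(** The axes of the new vector a which are not yet matched are paired with
fresh ones, where all coordinates on U vanish on both sides. The coordinate of
b along an axis only has to be equal to that of - g u for exactly those u in U
for which the coordinates of a and of - f u agree; other multiples of a and b
reduce to this case as U is closed under scaling. *)
Lemma matched_extend sa sb (a : M) : matched U f g sa sb -> inF a ->
  exists b sa' sb', inF b /\
    matched [set p : 'rV[K]_n * K | p.1 \in U]
      (fun p => f p.1 + p.2 *: a) (fun p => g p.1 + p.2 *: b) sa' sb'.
Proof.
move=> [sE [ua ub] [xa xb] h] Fa.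
pose ea := filter (fun Y => Y \notin sa) (axsupp a).
have [eb [ueb seb xeb nb]] := fresh_axes TN' sb (size ea).
pose sa' := sa ++ ea; pose sb' := sb ++ eb.
have ua' : uniq sa'.
  rewrite cat_uniq ua filter_uniq ?axsupp_uniq// andbT -all_predC;
    apply/allP => Y.
  by rewrite mem_filter => /andP[].
have ub' : uniq sb'.
  by rewrite cat_uniq ub ueb andbT -all_predC; apply/allP => Y /nb.
have sE' : size sa' = size sb' by rewrite !size_cat sE seb.
have xa' Y : Y \in sa' -> axis Y.
  by rewrite mem_cat mem_filter => /orP[/xa//|/andP[_ /axsupp_axis]].
have xb' Y : Y \in sb' -> axis Y by rewrite mem_cat => /orP[/xb|/xeb].
have suba : {subset axsupp a <= sa'}.
  move=> Y Ya; rewrite mem_cat mem_filter Ya andbT; by case: (Y \in sa).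
have Ff u : u \in U -> inF (f u) by move=> /h[[]].
have Fg u : u \in U -> inF (g u) by move=> /h[[]].
have h' i u : (i < size sa')%N -> u \in U ->
    pr (f u) (nth set0 sa' i) = 0 <-> pr (g u) (nth set0 sb' i) = 0.
  move=> ilt uU; have [_ [su1 su2] hi] := h _ uU.
  rewrite !nth_cat -sE; case: ltnP => ii; first exact: hi.
  have ilt' : (i - size sa < size ea)%N by rewrite ltn_subLR// -size_cat.
  have nz1 : nth set0 ea (i - size sa) \notin sa.
    by have := mem_nth set0 ilt'; rewrite mem_filter => /andP[].
  have nz2 : nth set0 eb (i - size sa) \notin sb.
    by apply: nb; apply: mem_nth; rewrite seb.
  split=> _; apply/eqP; apply: contraNT nz2.
    by rewrite -mem_axsupp => /su2.
  by rewrite -mem_axsupp => /su1; rewrite (negPf nz1).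
(* Along each pair of axes, b copies the value of g at a point of U where f
   has the coordinate of a; if there is none, it avoids all values of g. *)
have ex Z : exists z, Z \in sb' -> Z z /\ forall u, u \in U ->
    pr (f u) (nth set0 sa' (index Z sb')) +
      pr a (nth set0 sa' (index Z sb')) = 0 <->
    pr (g u) Z + z = 0.
  case: (boolP (Z \in sb')) => Zs; last by exists 0.
  have Zi : nth set0 sb' (index Z sb') = Z by rewrite nth_index.
  have ilt : (index Z sb' < size sa')%N by rewrite sE' index_mem.
  have {}h' u := h' _ u ilt; rewrite Zi in h'.
  set Y := nth set0 sa' _ in h' *.
  have hZ := xb' _ Zs.
  case: (pselect (exists2 u0, u0 \in U & pr (f u0) Y = pr a Y)) => [[u0 u0U
    <-]|no].
    exists (pr (g u0) Z) => _; split; first exact: (pr_in TN').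
    move=> u uU.
    rewrite -(prD TM _ (Ff _ uU) (Ff _ u0U)) -(prD TN' _ (Fg _ uU) (Fg _ u0U)).
    by rewrite -!linearD; apply: h'; exact: UD.
  have [z|z Zz zn] := @axis_avoid _ N Z [seq pr (g u) Z | u <- enum U] TN hZ.
    by case/mapP => u _ ->; exact: (pr_in TN').
  exists z => _; split=> // u uU.
  have nU : - 1 *: u \in U by exact: UZ.
  split=> e.
    case: no; exists (- 1 *: u) => //.
    rewrite linearZ /= (prZ TM) ?scaleN1r; last exact: Ff.
    by apply/eqP; rewrite eqr_oppLR -addr_eq0 e.
  case/negP: zn; apply/mapP; exists (- 1 *: u); first by rewrite mem_enum.
  rewrite linearZ /= (prZ TN') ?scaleN1r; last exact: Fg.
  apply/eqP.
  by rewrite eq_sym eqr_oppLR -addr_eq0 e.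
have [z hz] := choice ex.
pose c Z := if Z \in sb' then z Z else 0.
have dec : decomp (\sum_(Z <- sb') c Z) sb' c.
  split=> // Z Zs; last by rewrite /c (negPf Zs).
  by split; [exact: xb'|rewrite /c Zs; case: (hz _ Zs)].
set b := \sum_(Z <- sb') c Z in dec.
have [Fb prb] := decompP TN' dec.
exists b, sa', sb'; split=> //; split=> // -[u l]; rewrite inE /= => uU.
have Fu := Ff _ uU; have Gu := Fg _ uU.
have [_ [su1 su2] _] := h _ uU.
have FlM : inF (f u + l *: a).
  by rewrite addrC; case: (inF_submod TM) => _; apply.
have FlN : inF (g u + l *: b).
  by rewrite addrC; case: (inF_submod TN') => _; apply.
have prM Y : pr (f u + l *: a) Y = pr (f u) Y + l *: pr a Y.
  by rewrite addrC (pr_lin TM)// addrC.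
have prN Z : pr (g u + l *: b) Z = pr (g u) Z + l *: c Z.
  by rewrite addrC (pr_lin TN')// prb addrC.
split=> //.
  split=> Y; rewrite mem_axsupp ?prM ?prN => nz; apply: contraR nz => Ys.
    have : Y \notin axsupp (f u).
      by apply: contra Ys => /su1 ?; rewrite mem_cat; apply/orP; left.
    have : Y \notin axsupp a by apply: contra Ys => /suba.
    by rewrite !mem_axsupp !negbK => /eqP -> /eqP ->; rewrite scaler0 addr0.
  have : Y \notin axsupp (g u).
    by apply: contra Ys => /su2 ?; rewrite mem_cat; apply/orP; left.
  rewrite /c (negPf Ys) mem_axsupp negbK => /eqP ->; by rewrite scaler0 addr0.
move=> i ilt; rewrite prM prN.
have Zs : nth set0 sb' i \in sb' by rewrite mem_nth// -sE'.
have [_ ] := hz _ Zs; rewrite index_uniq// -?sE'// => {}hz.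
rewrite /c Zs; have [->|l0] := eqVneq l 0.
  by rewrite !scale0r !addr0; exact: h'.
have e (L : lmodType K) (x y : L) : x + l *: y = 0 <-> l^-1 *: x + y = 0.
  have -> : x + l *: y = l *: (l^-1 *: x + y).
    by rewrite scalerDr scalerA mulfV// scale1r.
  by split=> [/eqP|->]; rewrite ?scaler0// scaler_eq0 (negPf l0) => /eqP.
rewrite !e; have := hz _ (UZ l^-1 uU).
by rewrite !linearZ /= (prZ TM)// (prZ TN').
Qed.

End Extension.

(** Tuples that look alike when numbers of axes are only counted up to r; a
combination outside F looks like one on at least r axes. *)
Definition equiv (K : finFieldType) r (M N : LK_space K) n
    (v : 'I_n -> M) (w : 'I_n -> N) : Prop :=
  forall (C : {set 'rV[K]_n}) m, (m < r)%N ->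
    covered m (lin v) C <-> covered m (lin w) C.

Lemma Xpow_scale (K : finFieldType) (M : LK_space K) k (a : K) (x : M) :
  T_K M -> Xpow k x -> Xpow k (a *: x).
Proof.
move=> TM Xx; have := Xpow_lin TM a Xx (proj2 (Xpow0E TM 0) erefl).
by rewrite addn0 add0r.
Qed.

(** A sum over r axes, on each of which the coordinate avoids the finitely
many multiples of coordinates of combinations of w. *)
Lemma ex_generic (K : finFieldType) (N : LK_space K) n (w : 'I_n -> N) r :
  T_K_inf N -> exists b, forall u (l : K) k, l != 0 -> (k < r)%N ->
    ~ Xpow k (lin w u + l *: b).
Proof.
move=> TN; have TN' := TN.1.
have [t [ut st xt _]] := fresh_axes TN' [::] r.
have ex Z : exists z, Z \in t -> Z z /\ forall u (l : K), l != 0 ->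
    pr (lin w u) Z + l *: z <> 0.
  case: (boolP (Z \in t)) => Zt; last by exists 0.
  pose B := [seq - (p.2^-1 *: pr (lin w p.1) Z) | p : 'rV[K]_n * K].
  have [z|z Zz zn] := @axis_avoid _ N Z B TN (xt _ Zt).
    case/mapP => p _ ->; rewrite -scaleNr; apply: axis_scale => //;
      first exact: xt.
    by apply: (pr_in TN'); exact: xt.
  exists z => _; split=> // u l l0 e; case/negP: zn; apply/mapP.
  exists (u, l); rewrite ?mem_enum//=; apply/eqP; rewrite -addr_eq0 -[z]scale1r.
  by rewrite -(mulVf l0) -scalerA -scalerDr addrC e scaler0.
have [z hz] := choice ex.
pose c Z := if Z \in t then z Z else 0.
have dec : decomp (\sum_(Z <- t) c Z) t c.
  split=> // Z Zs; last by rewrite /c (negPf Zs).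
  by split; [exact: xt|rewrite /c Zs; case: (hz _ Zs)].
set b := \sum_(Z <- t) c Z in dec.
have [Fb prb] := decompP TN' dec.
exists b => u l k l0 kr /(XpowP TN')[Fs].
rewrite leqNgt => /negP; apply; apply: leq_trans kr _; rewrite -st.
have Fu : inF (lin w u).
  rewrite -[lin w u](addrK (l *: b)) addrC -scaleNr.
  by case: (inF_submod TN') => _; apply.
apply: uniq_leq_size => // Z Zt; rewrite mem_axsupp addrC (pr_lin TN')// addrC
  prb.
by rewrite /c Zt; apply/eqP; have [_] := hz _ Zt; apply.
Qed.

Section Game.
Variables (K : finFieldType) (n : nat).

Definition tail (c : 'rV[K]_n.+1) : 'rV[K]_n := \row_i c ord0 (lift ord0 i).

Lemma lin_push (V : lmodType K) (v : 'I_n -> V) x c :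
  lin (push v x) c = lin v (tail c) + c ord0 ord0 *: x.
Proof.
rewrite /lin big_ord_recl /push unlift_none addrC; congr (_ + _).
by apply: eq_bigr => i _; rewrite liftK mxE.
Qed.

(** A set of coefficient vectors that involves the new vector is not covered by
fewer than r axes in either model; the others only concern v and w. *)
Lemma equiv_push_generic r (M N : LK_space K) (v : 'I_n -> M)
    (w : 'I_n -> N) a :
  T_K M -> T_K_inf N -> equiv r v w ->
  (forall u m, (m < r)%N -> ~ Xpow m (lin v u + a)) ->
  exists b, equiv r (push v a) (push w b).
Proof.
move=> TM TN vw ha; have [b hb] := ex_generic w r TN.
exists b => C m mr.
case: (pselect (exists2 c, c \in C & c ord0 ord0 != 0)) => [[c cC c0]|no].
  split=> /covered_Xpow => [/(_ TM _ cC)|/(_ TN.1 _ cC)]; rewrite lin_push.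
    move=> /(Xpow_scale (c ord0 ord0)^-1 TM).
    by rewrite scalerDr scalerA mulVf// scale1r -linearZ => /ha; case.
  by move=> /hb; case.
have c0 c : c \in C -> c ord0 ord0 = 0.
  by move=> cC; apply/eqP/negPn/negP => ?; apply: no; exists c.
have e (L : LK_space K) (x : 'I_n -> L) y :
    covered m (lin (push x y)) C <-> covered m (lin x) (tail @: C).
  rewrite -covered_imset; apply: covered_ext => c /c0 cE.
  by rewrite lin_push cE scale0r addr0.
by rewrite !e; exact: vw.
Qed.

(** The combinations of a tuple which use at most 2r axes use at most
#|K^n| * 2r axes altogether; these must be counted exactly. *)
Definition bound r := (#|{: 'rV[K]_n}| * (2 * r)).+1.

Lemma bound_gt r : (2 * r < bound r)%N.
Proof.
rewrite ltnS leq_pmull//; apply/card_gt0P; by exists 0.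
Qed.

(** Here u0 makes a2 := lin v u0 + a short. The map h rewrites coefficients of
the extended tuple as a combination u of v plus a multiple of a2. If u is
outside U, the result uses at least r axes: otherwise lin v u would be on at
most 2r axes. *)
Lemma equiv_push_special r (M N : LK_space K) (v : 'I_n -> M) (w : 'I_n -> N)
    a u0 m0 : T_K M -> T_K_inf N -> equiv (bound r) v w ->
  (m0 < r)%N -> Xpow m0 (lin v u0 + a) ->
  exists b, equiv r (push v a) (push w b).
Proof.
move=> TM TN vw mr Xa; have TN' := TN.1.
(* The coefficients giving vectors on at most 2r axes. *)
pose low := [set u | `[< Xpow (2 * r) (lin v u) >]]%SET.
pose S := used_axes (lin v) low.
have lowP u : reflect (Xpow (2 * r) (lin v u)) (u \in low).
  by rewrite inE; exact: asboolP.
have sizeS : (size S < bound r)%N.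
  rewrite ltnS; apply: leq_trans (size_undup _) _.
  rewrite size_flatten /shape -map_comp sumnE big_map.
  apply: (@leq_trans (\sum_(u <- enum low) 2 * r)).
    rewrite big_seq [leqRHS]big_seq; apply: leq_sum => u.
    by rewrite mem_enum => /lowP/(XpowP TM)[].
  rewrite big_const_seq count_predT iter_addn_0 mulnC leq_mul2r -cardE max_card.
  by rewrite orbT.
pose U := [set u | `[< inF (lin v u) /\ {subset axsupp (lin v u) <= S} >]]%SET.
have UP u : reflect (inF (lin v u) /\ {subset axsupp (lin v u) <= S}) (u \in U).
  by rewrite inE; exact: asboolP.
have lowU u : u \in low -> u \in U.
  move=> ul; apply/UP; split; first by exists (2 * r)%N; exact/lowP.
  by move=> Y; rewrite mem_axsupp => nz; apply/mem_used_axesP; exists u.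
have covU : covered (size S) (lin v) U by exists S; split=> // u /UP.
have covU' : covered (size S) (lin w) U by apply/vw.
have sub0 : Xpow 0 (0 : M) by apply/(Xpow0E TM).
have U0 : 0 \in U.
  by apply/lowU/lowP; rewrite linear0; exact: (Xpow_mono TM _ sub0).
have UL x y z : y \in U -> z \in U -> x *: y + z \in U.
  move=> /UP[Fy sy] /UP[Fz sz]; apply/UP; rewrite linearP; split.
    by case: (inF_submod TM) => _; apply.
  move=> Y; rewrite mem_axsupp (pr_lin TM)//; apply: contraR => Ys.
  have : Y \notin axsupp (lin v y) by apply: contra Ys => /sy.
  have : Y \notin axsupp (lin v z) by apply: contra Ys => /sz.
  by rewrite !mem_axsupp !negbK => /eqP -> /eqP ->; rewrite scaler0 addr0.
have [sa [sb mU]] : exists sa sb, matched U (lin v) (lin w) sa sb.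
  apply: ex_matched => [u uU|C k CU].
    by split; [exact: covered_inF covU uU|exact: covered_inF covU' uU].
  case: (ltnP k (bound r)) => [/vw//|kr].
  split=> _; first exact: covered_mono (leq_trans (ltnW sizeS) kr) CU covU'.
  exact: covered_mono (leq_trans (ltnW sizeS) kr) CU covU.
set a2 := lin v u0 + a in Xa.
have Fa2 : inF a2 by exists m0.
have [b [sa' [sb' [Fb mU']]]] := matched_extend TM TN U0 UL mU Fa2.
have Xb : Xpow m0 b.
  have := @matched_covered _ _ _ _ _ [set (0, 1)]%SET _ _ _ _ m0 mU'.
  rewrite finset.sub1set inE => /(_ U0).
  rewrite (covered1 TM) (covered1 TN') /= !linear0 !add0r !scale1r.
  by case=> + _; apply.
pose h (c : 'rV[K]_n.+1) := (tail c - c ord0 ord0 *: u0, c ord0 ord0).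
exists (b - lin w u0) => C m mr'.
have ev c : lin (push v a) c = lin v (h c).1 + (h c).2 *: a2.
  rewrite lin_push /h /= [lin v (_ - _)]linearB /= [lin v (_ *: _)]linearZ /=.
  rewrite scalerDr addrA; congr (_ + _).
  by rewrite subrK.
have ew c : lin (push w (b - lin w u0)) c = lin w (h c).1 + (h c).2 *: b.
  rewrite lin_push /h /= [lin w (_ - _)]linearB /= [lin w (_ *: _)]linearZ /=.
  by rewrite scalerBr [c _ _ *: b - _]addrC addrA.
rewrite (covered_ext _ (fun c _ => ev c)) (covered_ext _ (fun c _ => ew c)).
case: (boolP (h @: C \subset [set p : 'rV[K]_n * K | p.1 \in U]%SET)) => CU.
  rewrite (covered_imset m h (fun p => lin v p.1 + p.2 *: a2)).
  rewrite (covered_imset m h (fun p => lin w p.1 + p.2 *: b)).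
  exact: matched_covered mU' CU.
case/subsetPn: CU => _ /imsetP[c cC ->]; rewrite inE => /negP nU.
have le2 : (m0 + m <= 2 * r)%N by rewrite mul2n -addnn leq_add// ltnW.
(* Vectors outside U stay long after adding a vector on m0 axes. *)
have out (L : LK_space K) (x y : L) (l : K) : T_K L -> Xpow m (x + l *: y) ->
    Xpow m0 y -> Xpow (2 * r) x.
  move=> TL Xx Xy; apply: (Xpow_mono TL le2).
  by have := Xpow_lin TL (- l) Xy Xx; rewrite scaleNr addrK.
split=> /covered_Xpow => [/(_ TM _ cC)|/(_ TN' _ cC)] Xc; case: nU;
  apply/lowU/lowP.
  exact: out TM Xc Xa.
apply/(covered1 TM _ (lin v)); apply/vw; first exact: bound_gt.
by apply/(covered1 TN'); exact: out TN' Xc Xb.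
Qed.

Lemma equiv_push r (M N : LK_space K) (v : 'I_n -> M) (w : 'I_n -> N) :
  T_K_inf M -> T_K_inf N -> equiv (bound r) v w ->
  forall a, exists b, equiv r (push v a) (push w b).
Proof.
move=> [TM _] TN vw a.
case: (pselect (exists u m, (m < r)%N /\ Xpow m (lin v u + a))).
  by move=> [u [m [mr Xm]]]; exact: (equiv_push_special TM TN vw mr Xm).
move=> no; apply: equiv_push_generic => //.
  move=> C m mr; apply: vw; apply: leq_trans mr _.
  by apply: leq_trans (ltnW (bound_gt r)); rewrite leq_pmull.
by move=> u m mr Xm; apply: no; exists u, m.
Qed.

End Game.

(** * Transferring hulls along partial isomorphisms *)

Lemma span_image (K : finFieldType) (V W : lmodType K) (f : {linear V -> W})
  (B : set V) : Defs.span (f @` B) = f @` Defs.span B.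
Proof.
apply/seteqP; split.
  have [s0 sL] := span_submod B.
  apply: span_min => [|_ [x Bx <-]]; last by exists x => //; exact: span_incl.
  split; first by exists 0 => //; rewrite linear0.
  move=> a _ _ [x Bx <-] [y By <-].
  by exists (a *: x + y); [exact: sL|rewrite linearP].
move=> _ [_ [n [c [b [hb ->]]]] <-]; exists n, c, (fun i => f (b i)).
split=> [i|]; first by exists (b i).
by rewrite linear_sum; apply: eq_bigr => i _; rewrite linearZ.
Qed.

(** Each spanning vector of the hull lies on one axis, so its coordinates are
itself and 0; by linearity the hull is closed under projections to axes. *)
Lemma hat_pr (K : finFieldType) (M : LK_space K) (A : set M) x : T_K M ->
  A `<=` inF (M := M) -> hat A x -> inF x /\ forall Y, hat A (pr x Y).
Proof.
move=> TM AF; rewrite (hatE TM); set B := [set y | _] => hx.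
have [s0 sL] := span_submod B; have [F0 FL] := inF_submod TM.
have sQ : submod [set x | inF x /\ forall Y, Defs.span B (pr x Y)].
  split=> [|a u v [Fu hu] [Fv hv]]; first by split=> // Y; rewrite pr0.
  by split=> [|Y]; [exact: FL|rewrite pr_lin//; exact: sL].
apply: (span_min sQ _ hx) => y [u Au su].
have [Z hZ yE] := supp_pr TM su; have Yy : Z y by rewrite yE; exact: pr_in.
split; first by apply: X_inF; exact: (axis_X TM hZ Yy).
move=> Y; rewrite (pr_axis TM _ hZ Yy); case: eqP => // _.
by apply: span_incl; exists u.
Qed.

Lemma sub_hat (K : finFieldType) (M : LK_space K) (A : set M) : T_K M ->
  A `<=` inF (M := M) -> A `<=` hat A.
Proof.
move=> TM AF x Ax; rewrite (hatE TM) (sum_pr TM (AF _ Ax)) big_seq.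
apply: submod_sum; first exact: span_submod.
move=> Y; rewrite mem_axsupp => /eqP nz; apply: span_incl; exists x => //.
exact: pr_supp.
Qed.

(** The map f0 identifies K^d with a subspace of F(M0) closed under
projections to axes. If f agrees with f0 about X, it sends the decomposition of
a vector over nonparallel elements of X to another one of the same length;
therefore f preserves weights, supports and hulls. *)
Section Transfer.
Variables (K : finFieldType) (M0 M : LK_space K) (d : nat).
Variables (f0 : {linear 'rV[K]_d -> M0}) (f : {linear 'rV[K]_d -> M}).
Hypotheses (TM0 : T_K M0) (TM : T_K M).
Hypotheses (i0 : injective f0) (i1 : injective f).
Hypothesis XX : forall u, Xpow 1 (f0 u) <-> Xpow 1 (f u).
Hypothesis closed : forall u, inF (f0 u) /\ forall Y, range f0 (pr (f0 u) Y).

Lemma transfer_nonparallel n (g : 'I_n -> 'rV[K]_d) :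
  nonparallel (fun i => f0 (g i)) -> nonparallel (fun i => f (g i)).
Proof.
move=> [Xg pg]; split=> [i|i j ij].
  have [Xi nz] := Xg i; split; first exact/XX.
  by move=> /= z; apply: nz; rewrite /= (i1 (etrans z (esym (linear0 f))))
    linear0.
by rewrite /parallel -linearD -XX linearD; exact: pg.
Qed.

Lemma transfer_decomp u : exists n (g : 'I_n -> 'rV[K]_d),
  nonparallel (fun i => f0 (g i)) /\ u = \sum_i g i.
Proof.
have [Fu cl] := closed u.
have [n [m [hm uE hp]]] := ex_nonparallel TM0 Fu.
have /choice[g hg] : forall i, exists w, f0 w = m i.
  by move=> i; have [Y _ ->] := hp i; have [w _ <-] := cl Y; exists w.
exists n, g; have -> : (fun i => f0 (g i)) = m by exact/funext.
split=> //; apply: i0; rewrite uE linear_sum; apply: eq_bigr => i _.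
by rewrite -hg.
Qed.

Lemma transfer_Xpow k u : Xpow k (f0 u) <-> Xpow k (f u).
Proof.
have [n [g [hg ->]]] := transfer_decomp u; rewrite !linear_sum.
by rewrite (nonparallel_Xpow TM0 hg) (nonparallel_Xpow TM (transfer_nonparallel
  hg)).
Qed.

Lemma nonparallel_supp (L : LK_space K) n (m : 'I_n -> L) y :
  T_K L -> nonparallel m -> supp (\sum_i m i) y <-> range m y.
Proof.
by move=> TL hm; rewrite (suppE TL _ (nonparallel_inF TL hm)) nonparallel_range.
Qed.

Lemma transfer_supp u : exists D : set 'rV[K]_d,
  supp (f0 u) = f0 @` D /\ supp (f u) = f @` D.
Proof.
have [n [g [hg ->]]] := transfer_decomp u; rewrite !linear_sum.
exists (range g); split; apply/seteqP; split=> y;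
  rewrite nonparallel_supp// ?image_comp//; exact: transfer_nonparallel.
Qed.

Lemma transfer_hat (P : set 'rV[K]_d) :
  range f0 = hat (f0 @` P) -> range f = hat (f @` P).
Proof.
rewrite !hatE//.
pose D := [set w | exists2 u, P u & supp (f0 u) (f0 w)].
have -> : [set y | exists2 x, (f0 @` P) x & supp x y] = f0 @` D.
  apply/seteqP; split=> [y [_ [u Pu <-] sy]|_ [w [u Pu sw] <-]].
    have [E [E0 _]] := transfer_supp u; move: (sy); rewrite E0 => -[w Ew wE].
    by exists w => //; exists u => //; rewrite wE.
  by exists (f0 u) => //; exists u.
have -> : [set y | exists2 x, (f @` P) x & supp x y] = f @` D.
  apply/seteqP; split=> [y [_ [u Pu <-] sy]|_ [w [u Pu sw] <-]].
    have [E [E0 E1]] := transfer_supp u; move: (sy); rewrite E1 => -[w Ew wE].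
    by exists w => //; exists u => //; rewrite E0; exists w.
  have [E [E0 E1]] := transfer_supp u; exists (f u); first by exists u.
  by move: sw; rewrite E0 E1 => -[w' Ew' /i0 <-]; exists w'.
rewrite !span_image => e; suff -> : Defs.span D = setT by [].
apply/seteqP; split=> // w _.
have : range f0 (f0 w) by exists w.
by rewrite e => -[w' Dw' /i0 <-].
Qed.

End Transfer.

(** * Patterns *)

Definition catv (T : Type) p n (e : 'I_p -> T) (v : 'I_n -> T) :
    'I_(p + n) -> T :=
  fun i => match fintype.split i with inl j => e j | inr j => v j end.

Lemma lin_catv (K : finFieldType) (V : lmodType K) p n (e : 'I_p -> V)
    (v : 'I_n -> V) u c :
  lin (catv e v) (row_mx u c) = lin e u + lin v c.
Proof.
rewrite /lin big_split_ord; congr (_ + _); apply: eq_bigr => i _.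
  by rewrite row_mxEl /catv -[lshift _ _]/(unsplit (inl i)) unsplitK.
by rewrite row_mxEr /catv -[rshift _ _]/(unsplit (inr i)) unsplitK.
Qed.

Lemma lin_delta (K : finFieldType) (V : lmodType K) n (v : 'I_n -> V) j :
  lin v (delta_mx ord0 j) = v j.
Proof.
rewrite /lin (bigD1 j)//= mxE !eqxx scale1r big1 ?addr0// => i ij.
by rewrite mxE (negPf ij) andbF scale0r.
Qed.

Lemma lin_of_linear (K : finFieldType) (V : lmodType K) n
  (f : {linear 'rV[K]_n -> V}) u : lin (fun i => f (delta_mx ord0 i)) u = f u.
Proof.
rewrite [in RHS](row_sum_delta u) linear_sum; apply: eq_bigr => i _.
by rewrite linearZ.
Qed.

Section Patterns.
Variable K : finFieldType.

Definition pattern n := {ffun 'rV[K]_n -> bool * bool}.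

(** The quantifier-free type of a tuple in the language with X alone; it is
finite because K is. *)
Definition pat (M : LK_space K) n (z : 'I_n -> M) : pattern n :=
  [ffun u => (`[< lin z u = 0 >], `[< Xpow 1 (lin z u) >])].

Lemma pat_eq (M0 M : LK_space K) n (z0 : 'I_n -> M0) (z : 'I_n -> M) u :
  pat z0 = pat z -> (lin z0 u = 0 <-> lin z u = 0) /\
    (Xpow 1 (lin z0 u) <-> Xpow 1 (lin z u)).
Proof.
move=> /ffunP/(_ u); rewrite !ffunE => -[e1 e2]; split.
  exact: asbool_eq_equiv.
exact: asbool_eq_equiv.
Qed.

(** A semantic form of being existential in the language with X alone: a tuple e
exists such that the pattern of e and v is one of those in S. *)
Definition pattern_definable n
    (R : forall M : LK_space K, ('I_n -> M) -> Prop) :=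
  exists p (S : {set pattern (p + n)}), forall M, T_K_inf M ->
    forall v : 'I_n -> M, R M v <-> exists e : 'I_p -> M, pat (catv e v) \in S.

(** S consists of all patterns of a tuple with a witness in some model. *)
Lemma pattern_definableP n (R : forall M : LK_space K, ('I_n -> M) -> Prop) p
    (Wit : forall M : LK_space K, ('I_p -> M) -> ('I_n -> M) -> Prop) :
  (forall M, T_K_inf M -> forall v, R M v <-> exists e, Wit M e v) ->
  (forall M0 M, T_K_inf M0 -> T_K_inf M -> forall e0 v0 e v,
     pat (catv e0 v0) = pat (catv e v) -> Wit M0 e0 v0 -> Wit M e v) ->
  pattern_definable R.
Proof.
move=> RW tr; exists p.
exists [set q | `[< exists M0, T_K_inf M0 /\ exists e0 v0,
   q = pat (catv e0 v0) /\ Wit M0 e0 v0 >]]%SET => M TM v.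
rewrite (RW M TM); split=> -[e].
  move=> We; exists e; rewrite inE; apply/asboolP.
  by exists M; split=> //; exists e, v.
rewrite inE => /asboolP[M0 [TM0 [e0 [v0 [E W0]]]]]; exists e.
exact: (tr _ _ TM0 TM _ _ _ _ (esym E)).
Qed.

(** The witness is a basis e of the hull in which the structure is the given
one. In another model with the same pattern, e has the same relations with a
and the same combinations in X, so the transfer of weights and hulls applies. *)
Lemma P_pattern marked (s : P_sym K marked) :
  pattern_definable (fun M (a : 'I_(P_ar s) -> M) => P_int a).
Proof.
case: s => k n t hs; rewrite /P_ar /P_int /=.
pose Wit (M : LK_space K) (e : 'I_(ht_dim t) -> M) (a : 'I_k.+1 -> M) :=
  [/\ Defs.span (range a) `<=` Xpow n, injective (lin e),
      range (lin e) = hat (Defs.span (range a)),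
      forall m u, Xpow m (lin e u) <-> u \in ht_X t m
    & marked -> forall j, lin e (ht_pt t j) = a j].
apply: (@pattern_definableP _ _ _ Wit) =>
  [M TM a|M0 M [TM0 _] [TM _] e0 a0 e a E].
  split=> [[sp [f [inj rg hX hm]]]|[e [sp inj rg hX hm]]]; last first.
    by split=> //; exists (lin e).
  exists (fun i => f (delta_mx ord0 i)).
  rewrite /Wit; have -> : lin (fun i => f (delta_mx ord0 i)) = f.
    by apply/funext => u; exact: lin_of_linear.
  by split.
case=> sp inj rg hX hm.
have Erow u c : lin e0 u + lin a0 c = 0 <-> lin e u + lin a c = 0.
  by rewrite -!lin_catv; case: (pat_eq (row_mx u c) E).
have E0 u : lin e0 u = 0 <-> lin e u = 0.
  by have := Erow u 0; rewrite !linear0 !addr0.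
have EX u : Xpow 1 (lin e0 u) <-> Xpow 1 (lin e u).
  by have [_] := pat_eq (row_mx u 0) E; rewrite !lin_catv !linear0 !addr0.
have inj1 : injective (lin e).
  move=> u u' h; apply/eqP; rewrite -subr_eq0; apply/eqP; apply: inj.
  by rewrite linear0; apply/E0; rewrite linearB /= h subrr.
have sF : Defs.span (range a0) `<=` inF (M := M0) by move=> x /sp; exists n.
have /choice[pt hpt] : forall j, exists u, lin e0 u = a0 j.
  move=> j; suff [u _ <-] : range (lin e0) (a0 j) by exists u.
  by rewrite rg; apply: (sub_hat TM0 sF); apply: span_incl; exists j.
have a0E : a0 = fun j => lin e0 (pt j) by apply/funext => j; rewrite hpt.
have aE : a = fun j => lin e (pt j).
  apply/funext => j; have := Erow (pt j) (- delta_mx ord0 j).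
  rewrite !linearN /= !lin_delta hpt subrr => -[/(_ erefl)/eqP + _].
  by rewrite subr_eq0 => /eqP.
have spE (L : LK_space K) (x : 'I_(ht_dim t) -> L) :
    Defs.span (range (fun j => lin x (pt j))) = lin x @` Defs.span (range pt).
  by rewrite -span_image image_comp.
have cl u : inF (lin e0 u) /\ forall Y, range (lin e0) (pr (lin e0 u) Y).
  rewrite rg; apply: (hat_pr TM0 sF); rewrite -rg; by exists u.
have tX := transfer_Xpow TM0 TM inj inj1 EX cl.
rewrite /Wit aE spE; split=> //.
- move=> _ [u hu <-]; apply/tX; apply: sp; rewrite a0E spE.
  by exists u.
- apply: (transfer_hat TM0 TM inj inj1 EX cl); by rewrite rg a0E spE.
- by move=> m u; rewrite -hX; exact: (iff_sym (tX m u)).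
move=> mk j; congr (lin e _); apply: inj; by rewrite hm// hpt.
Qed.

(** The witness e (c, i) is the part of lin v c on the i-th axis; that the parts
for fixed i lie on one axis means that their pairwise sums are in X. *)
Lemma covered_pattern m n (C : {set 'rV[K]_n}) :
  pattern_definable (fun M (v : 'I_n -> M) => covered m (lin v) C).
Proof.
pose I := ('rV[K]_n * 'I_m)%type.
pose Wit (M : LK_space K) (e : 'I_#|{: I}| -> M) (v : 'I_n -> M) :=
  let e c i := e (enum_rank (c, i)) in forall c, c \in C ->
  [/\ forall i, Xpow 1 (e c i),
      forall c' i, c' \in C -> Xpow 1 (e c i + e c' i)
    & \sum_i e c i = lin v c].
apply: (@pattern_definableP _ _ _ Wit) =>
  [M [TM _] v|M0 M [TM0 _] [TM _] e0 a0 e a E].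
  split=> [[s [sm hs]]|[e We]].
    pose y c i := pr (lin v c) (nth set0 (undup s) i).
    exists (fun j => let p : I := enum_val j in if p.1 \in C then y p.1 p.2
      else 0).
    move=> /= c cC; split=> [i|c' i c'C|].
    - by rewrite enum_rankK cC; exact: pr_X.
    - rewrite !enum_rankK cC c'C /y /=; set Y := nth _ _ _.
      case: (pselect (axis Y)) => hY.
        by apply: (axis_parallel TM hY); exact: pr_in.
      rewrite (_ : pr (lin v c) Y = 0) ?add0r; first exact: pr_X.
      by apply: contrapT => /pr_neq0.
    have [Fc sub] := hs c cC.
    under eq_bigr do rewrite enum_rankK cC /=.
    rewrite [RHS](sum_pr TM Fc) -(@sum_supported _ _ _ (undup s)) ?undup_uniq
      ?axsupp_uniq//.
    - rewrite (big_nth set0) big_mkord.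
      have sm' : (size (undup s) <= m)%N by exact: leq_trans (size_undup s) sm.
      rewrite (big_ord_widen _ (y c) sm') [in RHS]big_mkcond;
        apply: eq_bigr => i _.
      case: ltnP => // h; rewrite /y nth_default//.
      by apply: contrapT => /pr_neq0 /axis_zero.
    - by move=> Y Ys; rewrite mem_undup; exact: sub.
    by move=> Y; rewrite mem_axsupp negbK => /eqP.
  have /choice[Y hY] : forall i : 'I_m, exists Y, forall c, c \in C ->
      e (enum_rank (c, i)) = 0 \/ axis Y /\ Y (e (enum_rank (c, i))).
    move=> i.
    case: (pselect (exists2 c, c \in C & e (enum_rank (c, i)) <> 0));
      last first.
      move=> no; exists set0 => c cC; left; apply: contrapT => nz.
      by apply: no; exists c.
    move=> [c cC nz]; exists (ax (e (enum_rank (c, i)))) => c' c'C.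
    have [Xc pc _] := We c cC; have [Xc' _ _] := We c' c'C.
    case: (pselect (e (enum_rank (c', i)) = 0)) => [|nz']; [by left|right].
    split; first by apply: axis_ax; split=> //; exact: Xc.
    by left; split; [split=> //; exact: Xc'|exact: pc].
  exists [seq Y i | i <- enum 'I_m]; split;
    first by rewrite size_map size_enum_ord.
  move=> c cC; have [Xc _ <-] := We c cC.
  have Fc i : inF (e (enum_rank (c, i))) by apply: X_inF; exact: Xc.
  split; first by apply: submod_sum => //; exact: inF_submod.
  move=> Z; rewrite mem_axsupp (pr_sum TM)//; apply: contraR => Zn; apply/eqP.
  apply: big1 => i _; have [->|[hYi Yi]] := hY i c cC; first by rewrite pr0.
  rewrite (pr_axis TM _ hYi Yi); case: eqP => // ZE; case/negP: Zn.
  by rewrite ZE map_f// mem_enum.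
have Edelta (L : LK_space K) (x : 'I_#|{: I}| -> L) (y : 'I_n -> L) j :
    lin (catv x y) (row_mx (delta_mx ord0 j) 0) = x j.
  by rewrite lin_catv linear0 addr0 lin_delta.
have Edelta2 (L : LK_space K) (x : 'I_#|{: I}| -> L) (y : 'I_n -> L) j j' :
    lin (catv x y) (row_mx (delta_mx ord0 j + delta_mx ord0 j') 0) = x j + x j'.
  by rewrite lin_catv linear0 addr0 linearD /= !lin_delta.
rewrite /Wit /= => We c cC; have [Xc pc sc] := We c cC; split=> [i|c' i c'C|].
- have := Xc i; rewrite -(Edelta _ e0 a0) -(Edelta _ e a).
  exact: (proj1 (proj2 (pat_eq _ E))).
- have := pc c' i c'C; rewrite -(Edelta2 _ e0 a0) -(Edelta2 _ e a).
  exact: (proj1 (proj2 (pat_eq _ E))).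
pose q : 'rV[K]_#|{: I}| := \sum_(i < m) delta_mx ord0 (enum_rank (c, i)).
have Eq (L : LK_space K) (x : 'I_#|{: I}| -> L) (y : 'I_n -> L) :
    lin (catv x y) (row_mx q (- c)) = \sum_i x (enum_rank (c, i)) - lin y c.
  rewrite lin_catv linearN linear_sum /=; congr (_ - _).
  by apply: eq_bigr => i _; rewrite lin_delta.
apply/eqP; rewrite -subr_eq0 -Eq; apply/eqP.
have [[+ _] _] := pat_eq (row_mx q (- c)) E; apply.
by rewrite Eq sc subrr.
Qed.

End Patterns.

(** * Covers in terms of isomorphism types of hulls *)

Lemma range_lin (K : finFieldType) (V : lmodType K) p (e : 'I_p -> V) :
  range (lin e) = Defs.span (range e).
Proof.
apply/seteqP; split=> [_ [u _ <-]|].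
  by exists p, (fun i => u ord0 i), e; split=> // i; exists i.
apply: span_min => [|_ [j _ <-]]; last by exists (delta_mx ord0 j);
  rewrite ?lin_delta.
split; first by exists 0; rewrite ?linear0.
by move=> a _ _ [x _ <-] [y _ <-]; exists (a *: x + y) => //; rewrite linearP.
Qed.

(** A vanishing nontrivial combination makes one generator redundant. *)
Lemma ex_basis (K : finFieldType) (V : lmodType K) p (e : 'I_p -> V) :
  exists d (g : 'I_d -> V),
    [/\ (d <= p)%N, injective (lin g) & range (lin g) = range (lin e)].
Proof.
elim: p e => [|p IH] e.
  by exists 0%N, e; split=> // u v _; apply/rowP => -[].
case: (pselect (exists2 u, u != 0 & lin e u = 0)) => [[u u0 eu]|no]; last first.
  exists p.+1, e; split=> // x y xy; apply/eqP; rewrite -subr_eq0; apply/negPn.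
  by apply/negP => h; apply: no; exists (x - y); rewrite // linearB /= xy subrr.
have [j uj] : exists j, u ord0 j != 0 by apply/rV0Pn.
have [d [g [dp ig rg]]] := IH (fun i => e (lift j i)).
exists d, g; split=> //; first exact: leqW.
rewrite rg !range_lin; apply/seteqP; split; apply: span_mono => _ [i _ <-].
  by apply: span_incl; exists (lift j i).
case: (unliftP j i) => [i' ->|->]; first by apply: span_incl; exists i'.
have sS := span_submod (range (fun i => e (lift j i))).
have -> : e j = - (u ord0 j)^-1 *: \sum_i u ord0 (lift j i) *: e (lift j i).
  apply/eqP; rewrite scaleNr -addr_eq0 -[e j]scale1r -(mulVf uj) -scalerA
    -scalerDr.
  by move: eu; rewrite /lin (bigD1_ord j)//= => ->; rewrite scaler0.
apply: submodZ => //; apply: submod_sum => // i' _; apply: submodZ => //.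
by apply: span_incl; exists i'.
Qed.

Section Codes.
Variables (K : finFieldType) (marked : bool) (k m : nat).

(** Data for the finitely many isomorphism types of hulls of (k+1)-tuples
covered by m axes: the hull has dimension at most (k+1)m, and X^j contains all
of it for j at least m. *)
Definition code := {d : 'I_(#|{: 'I_k.+1 * 'I_m}|.+1) &
  ({ffun 'I_m -> {set 'rV[K]_d}} * {ffun 'I_k.+1 -> 'rV[K]_d})%type}.

Definition decode (c : code) : hat_type K k :=
  @HatType K k (tag c)
    (fun j => if insub j is Some i then (tagged c).1 i else [set: _]%SET)
    (tagged c).2.

(** The hull is spanned by the coordinates of the tuple along m axes, so it has
a basis of at most (k+1)m elements, and it is contained in X^m. *)
Lemma covered_possible (M : LK_space K) (a : 'I_k.+1 -> M) : T_K_inf M ->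
  covered m a [set: _]%SET ->
  exists2 c, possible_type marked m (decode c) & P_holds marked m (decode c) a.
Proof.
move=> TM [s [sm hs]]; have TM' := TM.1.
suff [c hc] : exists c, P_holds marked m (decode c) a.
  by exists c => //; exists M => //; exists a.
have {}hs j : inF (a j) /\ {subset axsupp (a j) <= s} by apply: hs; rewrite inE.
pose A := Defs.span (range a).
have sQ : submod [set x : M | inF x /\ {subset axsupp x <= s}].
  split=> [|b x y [Fx sx] [Fy sy]].
    by split=> [|Y]; [exact: inF0|rewrite mem_axsupp pr0// eqxx].
  split; first by case: (inF_submod TM') => _; apply.
  move=> Y; rewrite mem_axsupp (pr_lin TM')//; apply: contraR => Ys.
  have : Y \notin axsupp x by apply: contra Ys => /sx.
  have : Y \notin axsupp y by apply: contra Ys => /sy.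
  by rewrite !mem_axsupp !negbK => /eqP -> /eqP ->; rewrite scaler0 addr0.
have QX x : inF x /\ {subset axsupp x <= s} -> Xpow m x.
  move=> [Fx sx]; apply/(XpowP TM'); split=> //; apply: leq_trans sm.
  by apply: uniq_leq_size => //; exact: axsupp_uniq.
have AQ x : A x -> inF x /\ {subset axsupp x <= s}.
  by apply: (span_min sQ) => _ [j _ <-]; exact: hs.
have AF : A `<=` inF (M := M) by move=> x /AQ[].
pose e (i : 'I_#|{: 'I_k.+1 * 'I_m}|) : M :=
  let p := enum_val i in pr (a p.1) (nth set0 s p.2).
have rgE : range (lin e) = hat A.
  rewrite range_lin (hatE TM'); apply/seteqP; split; apply: span_mono.
    move=> _ [i _ <-]; rewrite /e /=; set p := enum_val i.
    case: (pselect (pr (a p.1) (nth set0 s p.2) = 0)) => [->|nz].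
      by case: (span_submod [set y | exists2 x, A x & supp x y]).
    apply: span_incl; exists (a p.1); last exact: pr_supp.
    by apply: span_incl; exists p.1.
  move=> y [x Ax sy]; have [Y hY ->] := supp_pr TM' sy.
  have [s0 sL] := span_submod (range e).
  have sR : submod [set x : M | inF x /\ forall Y, Defs.span (range e) (pr x
    Y)].
    split=> [|b u v [Fu hu] [Fv hv]].
      by split=> [|Z]; [exact: inF0|rewrite pr0].
    split=> [|Z]; last by rewrite pr_lin//; exact: sL.
    by case: (inF_submod TM') => _; apply.
  suff : inF x /\ forall Y, Defs.span (range e) (pr x Y) by case.
  apply: (span_min sR _ Ax) => _ [j _ <-]; have [Fj sj] := hs j; split=> // Z.
  case: (pselect (pr (a j) Z = 0)) => [->//|/eqP nz].
  have Zs : Z \in s by apply: sj; rewrite mem_axsupp.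
  have im : (index Z s < m)%N by apply: leq_trans sm; rewrite index_mem.
  apply: span_incl; exists (enum_rank (j, Ordinal im)) => //.
  by rewrite /e enum_rankK /= nth_index.
have [d [g [dp ig]]] := ex_basis e; rewrite rgE => rg.
have gQ u : Xpow m (lin g u).
  apply: QX.
  have : hat A (lin g u) by rewrite -rg; exists u.
  rewrite (hatE TM'); apply: (span_min sQ) => y [x Ax sy].
  have [Y hY yE] := supp_pr TM' sy; rewrite yE; have [Fx sx] := AQ _ Ax.
  have Yy : Y (pr x Y) by exact: pr_in.
  split; first by apply: X_inF; exact: pr_X.
  move=> Z; rewrite mem_axsupp (pr_axis TM' _ hY Yy).
  case: (Z =P Y) => [->|_]; last by rewrite eqxx.
  by move=> nz; apply: sx; rewrite mem_axsupp.
have /choice[pt hpt] : forall j, exists u, lin g u = a j.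
  move=> j; suff [u _ <-] : range (lin g) (a j) by exists u.
  by rewrite rg; apply: (sub_hat TM' AF); apply: span_incl; exists j.
have dlt : (d < #|{: 'I_k.+1 * 'I_m}|.+1)%N by rewrite ltnS.
exists (existT _ (Ordinal dlt)
  ([ffun j : 'I_m => [set u | `[< Xpow j (lin g u) >]]%SET], [ffun j => pt j])).
split; first by move=> x /AQ/QX.
exists (lin g); split=> //=.
  move=> j u; case: insubP => [i _ <-|]; first by rewrite ffunE inE;
    split=> [/asboolP|/asboolP].
  by rewrite -leqNgt => mj; rewrite inE; split=> // _;
    exact: (Xpow_mono TM' mj).
by move=> _ j; rewrite ffunE.
Qed.

(** If some member of the tuple has a nonzero coordinate along each Y in s, the
sum of these coordinates is in the hull and uses all axes of s; since the hull
is contained in X^m, there are at most m of them. *)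
Lemma P_holds_covered (M : LK_space K) (a : 'I_k.+1 -> M) (c : code) :
  T_K_inf M -> P_holds marked m (decode c) a -> covered m a [set: _]%SET.
Proof.
move=> [TM _] [sp [f [_ rg hX _]]].
have Fa j : inF (a j) by exists m; apply: sp; apply: span_incl; exists j.
apply/coveredP => //; set s := used_axes _ _.
have hatX x : hat (Defs.span (range a)) x -> Xpow m x.
  rewrite -rg => -[u _ <-]; apply/hX => /=.
  by case: insubP => [i|]; rewrite ?ltnn// inE.
have /choice[h hh] : forall Y, exists j, Y \in s -> pr (a j) Y <> 0.
  move=> Y; case: (boolP (Y \in s)) => [/mem_used_axesP[j _ /eqP nz]|_];
    first by exists j.
  by exists ord0.
pose c' Y := if Y \in s then pr (a (h Y)) Y else 0.
have dec : decomp (\sum_(Y <- s) c' Y) s c'.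
  split=> [|Y Ys|Y Ys|//]; first exact: used_axes_uniq.
    have hY : axis Y by exact: used_axes_axis Ys.
    by split=> //; rewrite /c' Ys; exact: pr_in.
  by rewrite /c' (negPf Ys).
set x := \sum_(Y <- s) _ in dec.
have /hatX/(XpowP TM)[_ xm] : hat (Defs.span (range a)) x.
  rewrite (hatE TM) /x big_seq; apply: submod_sum; first exact: span_submod.
  move=> Y Ys; apply: span_incl; rewrite /c' Ys; exists (a (h Y)).
    by apply: span_incl; exists (h Y).
  by apply: pr_supp => //; exact: hh.
apply: leq_trans xm; apply: uniq_leq_size; first exact: used_axes_uniq.
by move=> Y Ys; rewrite mem_axsupp (prE TM _ dec) /c' Ys; apply/eqP/hh.
Qed.

End Codes.

(** * Invariant properties of tuples *)

Section Invariance.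
Variable K : finFieldType.

Definition property n := forall M : LK_space K, ('I_n -> M) -> Prop.

(** The properties that a finite amount of counting axes decides, uniformly in
all models. *)
Definition invariant n (Phi : property n) := exists r, forall M N,
  T_K_inf M -> T_K_inf N -> forall (v : 'I_n -> M) (w : 'I_n -> N),
  equiv r v w -> Phi M v <-> Phi N w.

Lemma equiv_sym r (M N : LK_space K) n (v : 'I_n -> M) (w : 'I_n -> N) :
  equiv r v w -> equiv r w v.
Proof. by move=> h C m mr; apply: iff_sym; exact: h. Qed.

Lemma equiv_le r r' (M N : LK_space K) n (v : 'I_n -> M) (w : 'I_n -> N) :
  (r <= r')%N -> equiv r' v w -> equiv r v w.
Proof. by move=> rr h C m mr; apply: h; exact: leq_trans rr. Qed.

Lemma lin_lin (V : lmodType K) n p (cs : 'I_n -> 'rV[K]_p) (v : 'I_p -> V) u :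
  lin (fun i => lin v (cs i)) u = lin v (lin cs u).
Proof.
by rewrite [lin cs u]/lin linear_sum; apply: eq_bigr => i _; rewrite linearZ.
Qed.

Lemma equiv_lin r (M N : LK_space K) n p (cs : 'I_n -> 'rV[K]_p)
    (v : 'I_p -> M) (w : 'I_p -> N) : equiv r v w ->
  equiv r (fun i => lin v (cs i)) (fun i => lin w (cs i)).
Proof.
move=> h C m mr; rewrite (covered_ext _ (fun u _ => lin_lin cs v u)).
rewrite (covered_ext _ (fun u _ => lin_lin cs w u)).
by rewrite (covered_imset _ (lin cs) (lin v)) (covered_imset _ (lin cs) (lin
  w)); exact: h.
Qed.

Lemma invariant_ext n (Phi Psi : property n) :
  (forall M, T_K_inf M -> forall v, Phi M v <-> Psi M v) ->
  invariant Phi -> invariant Psi.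
Proof.
move=> h [r hr]; exists r => M N TM TN v w vw.
by rewrite -(h _ TM) -(h _ TN); exact: hr.
Qed.

Lemma invariant_covered m n (C : {set 'rV[K]_n}) :
  invariant (fun M v => covered m (lin v) C).
Proof. by exists m.+1 => M N _ _ v w; apply. Qed.

Lemma invariant_Xpow m n (c : 'rV[K]_n) : invariant (fun M v => Xpow m (lin v
    c)).
Proof.
apply: invariant_ext (invariant_covered m [set c]%SET) => M [TM _] v.
exact: covered1.
Qed.

Lemma invariant_lin n p (cs : 'I_n -> 'rV[K]_p) (Phi : property n) :
  invariant Phi -> invariant (fun M v => Phi M (fun i => lin v (cs i))).
Proof.
move=> [r h]; exists r => M N TM TN v w vw; apply: h => //; exact: equiv_lin.
Qed.

Lemma invariant_not n (Phi : property n) :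
  invariant Phi -> invariant (fun M v => ~ Phi M v).
Proof. by move=> [r h]; exists r => M N TM TN v w vw;
  rewrite (h M N TM TN v w vw). Qed.

Lemma invariant_and n (Phi Psi : property n) : invariant Phi -> invariant Psi ->
  invariant (fun M v => Phi M v /\ Psi M v).
Proof.
move=> [r h] [r' h']; exists (maxn r r') => M N TM TN v w vw.
rewrite (h M N TM TN v w); last by apply: equiv_le vw; exact: leq_maxl.
by rewrite (h' M N TM TN v w)//; apply: equiv_le vw; exact: leq_maxr.
Qed.

Lemma invariant_or n (Phi Psi : property n) : invariant Phi -> invariant Psi ->
  invariant (fun M v => Phi M v \/ Psi M v).
Proof.
move=> iP iQ; have := invariant_not (invariant_and (invariant_not iP)
  (invariant_not iQ)).
apply: invariant_ext => M _ v; split=> [|[h []//|h []//]].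
by move/not_andP => -[] /contrapT; [left|right].
Qed.

Lemma invariant_ex n (Phi : property n.+1) : invariant Phi ->
  invariant (fun M v => exists x, Phi M (push v x)).
Proof.
move=> [r h]; exists (bound K n r) => M N TM TN v w vw.
split=> -[x hx].
  by have [y xy] := equiv_push TM TN vw x; exists y; apply/(h _ _ TM TN _ _ xy).
have [y xy] := equiv_push TN TM (equiv_sym vw) x; exists y.
by apply/(h _ _ TN TM _ _ xy).
Qed.

Lemma invariant_all n (Phi : property n.+1) : invariant Phi ->
  invariant (fun M v => forall x, Phi M (push v x)).
Proof.
move=> /invariant_not/invariant_ex/invariant_not.
by apply: invariant_ext => M _ v; rewrite -forallNE; split=> h x;
  [apply: contrapT; exact: h|apply].
Qed.

End Invariance.

(** * Formulas *)

Section Formulas.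
Variables (K : finFieldType) (R : Type) (ar : R -> nat).
Variable Rint : forall (M : LK_space K) (r : R), ('I_(ar r) -> M) -> Prop.

Local Notation L := (L_vs_with K ar).

Definition interp (M : LK_space K) : structure L :=
  @Structure L M (@vs_fint K M) (@Rint M).

Lemma term_lin n (t : term L n) : exists c : 'rV[K]_n,
  forall (M : LK_space K) (v : 'I_n -> M), @eval L (interp M) n v t = lin v c.
Proof.
elim: t => [i|f ts IH].
  by exists (delta_mx ord0 i) => M v; rewrite lin_delta.
have [cs hcs] := choice IH.
case: f ts IH cs hcs => [||a] ts IH cs hcs.
- by exists (cs ord0 + cs ord_max) => M v; rewrite linearD /= -!hcs.
- by exists 0 => M v; rewrite linear0.
by exists (a *: cs ord0) => M v; rewrite linearZ /= -hcs.
Qed.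

Lemma lin_term n (c : 'rV[K]_n) : exists t : term L n,
  forall (M : LK_space K) (v : 'I_n -> M), @eval L (interp M) n v t = lin v c.
Proof.
suff h (s : seq 'I_n) : exists t : term L n, forall (M : LK_space K) (v : 'I_n
  -> M),
    @eval L (interp M) n v t = \sum_(i <- s) c ord0 i *: v i.
  by have [t ht] := h (index_enum _); exists t => M v; rewrite ht.
elim: s => [|i s [t ht]].
  have ts : 'I_(far (l := L) (@VZero K)) -> term L n by case.
  by exists (@App L n (@VZero K) ts) => M v; rewrite big_nil.
exists (@App L n (@VAdd K) (fun j => if j == ord0
  then @App L n (VScal (c ord0 i)) (fun=> @Var L n i) else t)) => M v.
by rewrite big_cons /= ht.
Qed.

Lemma formula_invariant n (phi : formula L n) :
  (forall r : R, invariant (fun M => @Rint M r)) ->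
  invariant (fun M v => @sat L (interp M) n phi v).
Proof.
move=> hR; elim: phi => {n} [n|n s t|n r ts|n p IH|n p IHp q IHq|n p IHp q
  IHq|n p IH|n p IH] /=.
- by exists 0%N.
- have [c hc] := term_lin s; have [c' hc'] := term_lin t.
  apply: invariant_ext (invariant_Xpow 0 (c - c')) => M [TM _] v.
  rewrite hc hc' (Xpow0E TM) linearB /=.
  by split=> [/eqP|->]; rewrite ?subrr// subr_eq0 => /eqP.
- have [cs hcs] := choice (fun j => term_lin (ts j)).
  apply: invariant_ext (invariant_lin cs (hR r)) => M _ v.
  by rewrite (_ : (fun i => lin v (cs i)) = fun j => @eval L (interp M) n v (ts
    j));
    last by apply/funext => j; rewrite hcs.
- exact: (invariant_not IH).
- exact: (invariant_and IHp IHq).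
- exact: (invariant_or IHp IHq).
- exact: (invariant_ex IH).
exact: (invariant_all IH).
Qed.

(** ** Definability *)

Section Class.
Variable G : forall n, formula L n -> bool.

Definition defines n (phi : formula L n) (Phi : property K n) :=
  forall M, T_K_inf M -> forall v, @sat L (interp M) n phi v <-> Phi M v.

(** Definability by a formula of the syntactic class G, uniformly in all models
of the theory. *)
Definition definable n (Phi : property K n) :=
  exists2 phi, G phi & defines phi Phi.

Hypotheses (Gbot : forall n, G (FBot L n))
  (Gnot : forall n (p : formula L n), G p -> G (FNot p))
  (Gand : forall n (p q : formula L n), G p -> G q -> G (FAnd p q))
  (Gor : forall n (p q : formula L n), G p -> G q -> G (FOr p q)).

Lemma definable_ext n (Phi Psi : property K n) :
  (forall M, T_K_inf M -> forall v, Phi M v <-> Psi M v) ->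
  definable Phi -> definable Psi.
Proof. by move=> h [p Gp hp]; exists p => // M TM v; rewrite hp// h. Qed.

Lemma definable_not n (Phi : property K n) :
  definable Phi -> definable (fun M v => ~ Phi M v).
Proof.
move=> [p Gp hp]; exists (FNot p); first exact: Gnot.
by move=> M TM v /=; rewrite hp.
Qed.

Lemma definable_const n (P : Prop) : @definable n (fun _ _ => P).
Proof.
have [h|h] := pselect P; last by exists (FBot L n) => // M TM v; split=> // /h.
by exists (FNot (FBot L n)) => [|M TM v /=]; [exact: Gnot|split=> // _ []].
Qed.

Lemma definable_and n (Phi Psi : property K n) : definable Phi -> definable Psi
    ->
  definable (fun M v => Phi M v /\ Psi M v).
Proof.
move=> [p Gp hp] [q Gq hq]; exists (FAnd p q); first exact: Gand.
by move=> M TM v /=; rewrite hp// hq.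
Qed.

Lemma definable_exists n (I : finType) (Phi : I -> property K n) :
  (forall i, definable (Phi i)) -> definable (fun M v => exists i, Phi i M v).
Proof.
move=> h; suff [p Gp hp] : definable (fun M v => exists2 i, i \in enum I & Phi
  i M v).
  exists p => // M TM v; rewrite hp//; split=> [[i]|[i]]; exists i => //.
  exact: mem_enum.
elim: (enum I) => [|i s [q Gq hq]]; first by exists (FBot L n) => // M TM v;
  split=> // -[].
have [p Gp hp] := h i; exists (FOr p q); first exact: Gor.
move=> M TM v /=; rewrite hp// hq//; split=> [[pi|[j js pj]]|[j]].
- by exists i => //; exact: mem_head.
- by exists j; rewrite // inE js orbT.
by rewrite inE => /orP[/eqP ->|js] pj; [left|right; exists j].
Qed.

Lemma definable_forall n (I : finType) (Phi : I -> property K n) :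
  (forall i, definable (Phi i)) -> definable (fun M v => forall i, Phi i M v).
Proof.
move=> h; have := definable_not (definable_exists (fun i => definable_not (h
  i))).
apply: definable_ext => M TM v; rewrite -forallNE.
by split=> hi i; [apply: contrapT; exact: hi|apply].
Qed.

Lemma definable_bool n (Phi : property K n) (b : bool) :
  definable Phi -> definable (fun M v => `[< Phi M v >] = b).
Proof.
move=> h; case: b; [apply: definable_ext h|apply: definable_ext (definable_not
  h)].
  by move=> M TM v; split=> [/asboolT|/asboolW].
by move=> M TM v; split=> [/asboolF|/asboolPn].
Qed.

(** An invariant property is the disjunction of the finitely many r-equivalence
classes on which it holds, and each class is described by a boolean combination
of the properties [covered m (lin v) C]. *)
Lemma definable_invariant n (Phi : property K n) :
  (forall m (C : {set 'rV[K]_n}), definable (fun M v => covered m (lin v) C)) ->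
  invariant Phi -> definable Phi.
Proof.
move=> hcov [r hr].
pose J := ({set 'rV[K]_n} * 'I_r)%type.
pose cls (M : LK_space K) (v : 'I_n -> M) (x : J) :=
  `[< covered x.2 (lin v) x.1 >].
pose good (q : {ffun J -> bool}) := exists M, T_K_inf M /\ exists v : 'I_n -> M,
  (forall x, cls M v x = q x) /\ Phi M v.
have : definable (fun M v => exists q : {ffun J -> bool},
    good q /\ forall x, cls M v x = q x).
  apply: definable_exists => q; apply: definable_and;
    first exact: definable_const.
  by apply: definable_forall => x; apply: definable_bool; exact: hcov.
apply: definable_ext => M TM v; split; last first.
  move=> hv; exists [ffun x => cls M v x]; split=> [|x]; last by rewrite ffunE.
  by exists M; split=> //; exists v; split=> // x; rewrite ffunE.
case=> q [[N [TN [w [wq Pw]]]] vq]; suff vw : equiv r v w by apply/(hr _ _ TM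
  TN _ _ vw).
move=> C m mr; have := vq (C, Ordinal mr); rewrite -wq /cls /=.
exact: asbool_eq_equiv.
Qed.

End Class.

Lemma definable_qf_eq0 n (c : 'rV[K]_n) :
  definable (@quantifier_free L) (fun M v => lin v c = 0).
Proof.
have [t ht] := lin_term c; have [z hz] := lin_term (0 : 'rV[K]_n).
by exists (FEq t z) => // M TM v /=; rewrite ht hz linear0.
Qed.

(** ** Existential blocks *)

Fixpoint FExs p n : formula L (p + n) -> formula L n :=
  if p is p'.+1 return formula L (p + n) -> formula L n
  then fun phi => @FExs p' n (@FEx L (p' + n) phi) else fun phi => phi.

Lemma existential_FExs p n (phi : formula L (p + n)) :
  existential (FExs phi) = existential phi.
Proof. by elim: p phi => //= p IH phi; rewrite IH. Qed.

Lemma push_catv (T : Type) p n (e : 'I_p -> T) (v : 'I_n -> T) x :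
  push (catv e v) x = catv (push e x) v.
Proof.
apply/funext => i; rewrite /push /catv.
case: (unliftP ord0 i) => [j ->|->]; last first.
  rewrite (_ : ord0 = lshift n (ord0 : 'I_p.+1)); last exact: val_inj.
  by rewrite -[lshift _ _]/(unsplit (inl _)) unsplitK unlift_none.
case: (split_ordP j) => k ->.
  rewrite (_ : lift ord0 (lshift n k) = lshift n (lift ord0 k));
    last exact: val_inj.
  rewrite -[lshift n (lift _ _)]/(unsplit (inl _)) unsplitK liftK.
  by [].
rewrite (_ : lift ord0 (rshift p k) = rshift p.+1 k); last exact: val_inj.
by rewrite -[rshift p.+1 _]/(unsplit (inr _)) unsplitK.
Qed.

Lemma sat_FExs (M : LK_space K) p n (phi : formula L (p + n)) v :
  @sat L (interp M) n (FExs phi) v <->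
  exists e : 'I_p -> M, @sat L (interp M) _ phi (catv e v).
Proof.
elim: p phi => [|p IH] phi /=.
  have e0 (e : 'I_0 -> M) : catv e v = v.
    apply/funext => i; rewrite /catv; case: (split_ordP i) => -[]// j lt ->.
    by congr v; exact: val_inj.
  split=> [h|[e]]; last by rewrite e0.
  have e : 'I_0 -> M by case.
  by exists e; rewrite e0.
rewrite IH /=; split=> [[e [x]]|[e h]].
  by exists (push e x); rewrite -push_catv.
exists (fun i => e (lift ord0 i)), (e ord0); rewrite push_catv.
suff -> : push (fun i => e (lift ord0 i)) (e ord0) = e by [].
by apply/funext => i; rewrite /push; case: unliftP => [j ->|->].
Qed.

(** Membership of a pattern in S is quantifier free, since patterns are finite
objects. *)
Lemma existential_pattern n (Phi : property K n) :
  (forall m (c : 'rV[K]_m),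
     definable (@quantifier_free L) (fun M v => Xpow 1 (lin v c))) ->
  pattern_definable Phi -> definable (@existential L) Phi.
Proof.
move=> hX [p [S hS]].
have [phi qphi hphi] : definable (@quantifier_free L)
    (fun M (z : 'I_(p + n) -> M) => exists q : pattern K (p + n), q \in S /\
      forall u, `[< lin z u = 0 >] = (q u).1 /\
        `[< Xpow 1 (lin z u) >] = (q u).2).
  have qor m (a b : formula L m) : quantifier_free a -> quantifier_free b ->
    quantifier_free (FOr a b) by move=> /= -> ->.
  have qand m (a b : formula L m) : quantifier_free a -> quantifier_free b ->
    quantifier_free (FAnd a b) by move=> /= -> ->.
  apply: definable_exists => // q; apply: definable_and => //.
    exact: definable_const.
  apply: definable_forall => // u; apply: definable_and => //.
    by apply: definable_bool => //; exact: definable_qf_eq0.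
  by apply: definable_bool => //; exact: hX.
exists (FExs phi).
  by rewrite existential_FExs; case: (phi) qphi.
move=> M TM v; rewrite sat_FExs (hS M TM); split=> -[e he]; exists e.
  move/(hphi M TM): he => [q [qS hq]]; suff -> : pat (catv e v) = q by [].
  by apply/ffunP => u; rewrite ffunE; have [-> ->] := hq u; case: (q u).
apply/(hphi M TM); exists (pat (catv e v)); split=> // u.
by rewrite ffunE.
Qed.

Lemma bool_comb_qf n (phi : formula L n) :
  quantifier_free phi -> bool_comb_existential phi.
Proof.
by elim: phi => //= m p IHp q IHq /andP[/IHp -> /IHq ->].
Qed.

Lemma bool_comb_ex n (phi : formula L n) :
  existential phi -> bool_comb_existential phi.
Proof.
case: phi => //= m.
- by move=> p; exact: bool_comb_qf.
- by move=> p q /andP[/bool_comb_qf -> /bool_comb_qf ->].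
by move=> p q /andP[/bool_comb_qf -> /bool_comb_qf ->].
Qed.

End Formulas.

(** * The theorem *)

Section Main.
Variable K : finFieldType.

Let XK (M : LK_space K) (n : nat) (a : 'I_1 -> M) : Prop := Xpow n (a ord0).
Let XX (M : LK_space K) (_ : unit) (a : 'I_1 -> M) : Prop := Xpow 1 (a ord0).

Lemma L_K_X m (c : 'rV[K]_m) :
  definable XK (@quantifier_free (L_K K)) (fun M v => Xpow 1 (lin v c)).
Proof.
have [t ht] := lin_term XK c.
exists (@FRel (L_K K) m 1%N (fun=> t)) => // M TM v.
by rewrite /= /XK ht.
Qed.

Lemma L_X_X m (c : 'rV[K]_m) :
  definable XX (@quantifier_free (L_X K)) (fun M v => Xpow 1 (lin v c)).
Proof.
have [t ht] := lin_term XX c.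
exists (@FRel (L_X K) m tt (fun=> t)) => // M TM v.
by rewrite /= /XX ht.
Qed.

Lemma P_L_K marked (s : P_sym K marked) : P_definable_LK s.
Proof.
have [phi ephi h] := existential_pattern L_K_X (P_pattern s).
by exists phi; split=> // M TM a; exact: (iff_sym (h M TM a)).
Qed.

Lemma P_L_X marked (s : P_sym K marked) : P_definable_LX s.
Proof.
have [phi ephi h] := existential_pattern L_X_X (P_pattern s).
by exists phi; split=> // M TM a; exact: (iff_sym (h M TM a)).
Qed.

Lemma L_X_invariant n (phi : formula (L_X K) n) :
  invariant (fun M v => @sat _ (LX_structure M) n phi v).
Proof.
apply: (@formula_invariant _ _ _ XX) => -[].
by apply: invariant_ext (invariant_Xpow 1 (delta_mx ord0 ord0)) => M _ v;
  rewrite lin_delta.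
Qed.

(** The predicates P are equivalent to formulas in the language with X, whose
atoms are invariant. *)
Lemma P_invariant marked (s : P_sym K marked) :
  invariant (fun M (a : 'I_(P_ar s) -> M) => P_int a).
Proof.
have [phi [_ h]] := P_L_X s; apply: invariant_ext (L_X_invariant phi) => M TM v.
exact: (iff_sym (h M TM v)).
Qed.

Let LPint marked (M : LK_space K) (r : nat + P_sym K marked) :=
  @LP_rint K marked M r.

Lemma LP_invariant marked n (phi : formula (L_P K marked) n) :
  invariant (fun M v => @sat _ (LP_structure marked M) n phi v).
Proof.
apply: (@formula_invariant _ _ _ (@LPint marked)) => -[m|s].
  by apply: invariant_ext (invariant_Xpow m (delta_mx ord0 ord0)) => M _ v;
    rewrite lin_delta.
exact: P_invariant.
Qed.

(** The combinations in C as a nonempty tuple: the default value of [nth] adds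
the combination 0, which uses no axis. *)
Lemma covered_enum (M : LK_space K) n m (v : 'I_n -> M) (C : {set 'rV[K]_n}) :
  T_K M -> covered m (lin v) C <->
  covered m (fun j : 'I_#|C|.+1 => lin v (nth 0 (enum C) j)) [set: _]%SET.
Proof.
move=> TM; split=> -[s [sm hs]]; exists s; split=> // t.
  move=> _; case: (ltnP t #|C|) => tC.
    by apply: hs; rewrite -mem_enum mem_nth// -cardE.
  rewrite nth_default -?cardE// linear0; split; first exact: inF0.
  by move=> Y; rewrite mem_axsupp pr0// eqxx.
move=> tC; have lt : (index t (enum C) < #|C|.+1)%N.
  by rewrite ltnS ltnW// cardE index_mem mem_enum.
by have := hs (Ordinal lt); rewrite /= nth_index ?mem_enum// inE; apply.
Qed.

Lemma LP_covered marked n m (C : {set 'rV[K]_n}) :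
  definable (@LPint marked) (@quantifier_free (L_P K marked))
    (fun M v => covered m (lin v) C).
Proof.
pose k := #|C|.
have [ts hts] := choice (fun j : 'I_k.+1 => lin_term (@LPint marked) (nth 0
  (enum C) j)).
apply: (@definable_ext _ _ _ _ _ _ (fun M v => exists c : code K k m,
    possible_type marked m (decode c) /\
    P_holds marked m (decode c) (fun j : 'I_k.+1 => lin v (nth 0 (enum C) j)))).
  move=> M TM v; rewrite (covered_enum _ _ _ TM.1); split.
    by move=> [c [_ h]]; exact: P_holds_covered TM h.
  by move=> /(covered_possible marked TM)[c pc hc]; exists c.
apply: definable_exists => //= [? p q -> ->//|c].
case: (pselect (possible_type marked m (decode c))) => [pc|npc]; last first.
  by exists (FBot _ n) => // M TM v /=; split=> // -[].
exists (@FRel (L_P K marked) n (inr (PSym pc)) ts) => // M TM v /=.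
rewrite (_ : (fun j => eval v (ts j)) = fun j => lin v (nth 0 (enum C) j)).
  by split=> [|[]].
by apply/funext => j; exact: hts.
Qed.

Lemma LP_elimination marked n (phi : formula (L_P K marked) n) :
  definable (@LPint marked) (@quantifier_free (L_P K marked))
    (fun M v => @sat _ (LP_structure marked M) n phi v).
Proof.
apply: definable_invariant (LP_invariant phi) => //.
- by move=> ? p q /= -> ->.
- by move=> ? p q /= -> ->.
by move=> m C; exact: LP_covered.
Qed.

Lemma LX_near_model_complete n (phi : formula (L_X K) n) :
  definable XX (@bool_comb_existential (L_X K))
    (fun M v => @sat _ (LX_structure M) n phi v).
Proof.
apply: definable_invariant (L_X_invariant phi) => //.
- by move=> ? p q /= -> ->.
- by move=> ? p q /= -> ->.
move=> m C; have [psi epsi h] := existential_pattern L_X_X (covered_pattern m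
  C).
by exists psi => //; exact: bool_comb_ex.
Qed.

End Main.

Close Scope ring_scope.
Close Scope classical_set_scope.

(* "The isomorphism type" may be read with or without a_0, ..., a_k as
   distinguished elements; the statement covers both readings. *)
Theorem mainTheorem3 (K : finFieldType) :
  (forall marked : bool,
    [/\ quantifier_elimination (@LP_models K marked),
        forall s : P_sym K marked, P_definable_LK s
      & forall s : P_sym K marked, P_definable_LX s]) /\
  near_model_complete (@LX_models K).
Proof.
split=> [marked|n phi]; first split=> [n phi|s|s].
- have [psi qpsi h] := LP_elimination phi; exists psi; split=> // _ [M TM ->] v.
  exact: (iff_sym (h M TM v)).
- exact: P_L_K.
- exact: P_L_X.
have [psi qpsi h] := LX_near_model_complete phi; exists psi.
split=> // _ [M TM ->] v; exact: (iff_sym (h M TM v)).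
Qed.
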